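(* Let $F$ be a finite field of odd characteristic with $q=|F|$ elements. Then the number of isomorphism classes of $4$-dimensional nilpotent associative algebras over $F$ is $5q+20$.
   Context: Algebras are associative algebras over $F$, not assumed unital; an algebra is nilpotent if all products of $n$ elements vanish for some $n$. *)

(* Defs.v *)
From HB Require Import structures.
From mathcomp Require Import all_boot all_order all_algebra.

Set Implicit Arguments.
Unset Strict Implicit.
Unset Printing Implicit Defensive.

Import GRing.Theory.
Local Open Scope ring_scope.

(* The [falgType] of the library is unital, hence this structure. *)
Record assocAlg (F : fieldType) : Type := AssocAlg {
  alg_sort :> vectType F;
  alg_mul : {bilinear alg_sort -> alg_sort -> alg_sort};
  alg_mulA : forall x y z : alg_sort,
    alg_mul x (alg_mul y z) = alg_mul (alg_mul x y) z
}.

Definition alg_dim (F : fieldType) (A : assocAlg F) : nat := \dim {: A}.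

(* The left-bracketed product of the nonempty sequence x :: s; the empty
   product does not exist in a non-unital algebra. *)
Definition alg_prod (F : fieldType) (A : assocAlg F) (x : A) (s : seq A) : A :=
  foldl (fun y z : A => alg_mul A y z) x s.

(* All products of n.+1 elements vanish for some n.  Starting at one factor
   avoids the vacuous case of products of zero elements. *)
Definition alg_nilpotent (F : fieldType) (A : assocAlg F) : Prop :=
  exists n : nat, forall (x : A) (s : seq A), size s = n -> alg_prod x s = 0.

Definition alg_iso (F : fieldType) (A B : assocAlg F) : Prop :=
  exists2 f : {linear A -> B},
    bijective f &
    forall x y : A, f (alg_mul A x y) = alg_mul B (f x) (f y).

(* The algebras satisfying P form exactly N isomorphism classes: there is a
   complete and irredundant system of N representatives. *)
Definition iso_class_number (F : fieldType) (P : assocAlg F -> Prop) (N : nat)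
  : Prop :=
  exists r : 'I_N -> assocAlg F,
    [/\ forall i : 'I_N, P (r i),
        forall i j : 'I_N, alg_iso (r i) (r j) -> i = j &
        forall A : assocAlg F, P A -> exists i : 'I_N, alg_iso A (r i)].

(* Main.v *)
(* Put d = dim A/A^2. If A^3 = 0, then A is determined by the e = 4 - d
   bilinear forms on the d-dimensional space A/A^2 that give the coordinates
   of the product in A^2; they are linearly independent, so e <= d^2, and only
   e = 0, 1, 2 are possible. Isomorphism of algebras is congruence of the
   forms combined with a change of basis of A^2.
   - e = 0: the zero algebra.
   - e = 1: nonzero bilinear forms on F^3 up to congruence and scaling.
     Splitting a form into its symmetric part S and its skew part K, and
     looking at the radical of K, gives 2q + 9 classes.
   - e = 2: two-dimensional spaces of bilinear forms on F^2 up to congruence.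
     Three of them contain the skew form. In the others the symmetric parts
     form a plane, the orthogonal of a binary form x^2 - t y^2 with t = 0, 1
     or a fixed nonsquare, and the skew part is a linear form on this plane.
     For t = 0 there are q + 1 classes, and for t != 0 the classes are
     separated by the value of a quadratic form at the linear form, which
     gives q + 1 and q classes.
   If A^3 != 0, some x has x^3 != 0. Either x^4 != 0 and A is spanned by the
   powers of x, or x, x^2, x^3 can be completed by some y with x y = 0, y x =
   b x^3, y^2 = g x^3, and b, g can be scaled to 0 or 1: 5 classes.
   The sum is 1 + (2q + 9) + (3q + 5) + 5. *)
Require Import Defs.
From HB Require Import structures.
From mathcomp Require Import all_boot all_order all_algebra.
From mathcomp Require Import ring.

Set Implicit Arguments.
Unset Strict Implicit.
Unset Printing Implicit Defensive.

Import GRing.Theory.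
Local Open Scope ring_scope.

(** Finiteness enters the normal forms through two facts: the nonzero elements form two square
    classes, and a nondegenerate binary form takes every value, so that it is determined by its
    discriminant under substitutions of determinant 1. The terms in q come from invariants that are
    elements of F itself and not classes modulo squares. For a ternary form with K != 0, an
    equivalence multiplies K by the scaling factor times the determinant of the substitution modulo
    the radical of K. Keeping K normalised makes this product 1, so the discriminant of the
    symmetric part on the other two coordinates, once split off, cannot be rescaled. For a pencil
    with t != 0, the skew part is an element mu = al + be sqrt t, and the substitutions that
    preserve the plane of symmetric parts multiply mu by some z / conj z, up to sign and
    conjugation; hence the norm of mu is fixed. When A^3 != 0, an x with x^3 != 0 exists because A
    is either generated by one element or has all its products proportional modulo A^3. *)

Definition class_count (X : Type) (E : X -> X -> Prop) (P : X -> Prop)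
    (N : nat) : Prop :=
  exists r : 'I_N -> X,
    [/\ forall i : 'I_N, P (r i),
        forall i j : 'I_N, E (r i) (r j) -> i = j &
        forall x : X, P x -> exists i : 'I_N, E x (r i)].

(** A finite type built from sums and products can index the families of a classification; the count
    is then the cardinal of that type. *)
Lemma class_count_reps (X : Type) (E : X -> X -> Prop) (P : X -> Prop)
    (T : finType) (r : T -> X) :
  (forall t, P (r t)) -> (forall s t, E (r s) (r t) -> s = t) ->
  (forall x, P x -> exists t, E x (r t)) -> class_count E P #|T|.
Proof.
move=> Pr rI rE; exists (fun i => r (enum_val i)); split=> // [i j /rI|x Px].
  exact: enum_val_inj.
by have [t Et] := rE x Px; exists (enum_rank t); rewrite enum_rankK.
Qed.

Lemma class_count_split (X : Type) (E : X -> X -> Prop) (P Q1 Q2 : X -> Prop)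
    (m n : nat) :
  (forall x, P x <-> Q1 x \/ Q2 x) ->
  (forall x y, Q1 x -> Q2 y -> ~ E x y /\ ~ E y x) ->
  class_count E Q1 m -> class_count E Q2 n -> class_count E P (m + n).
Proof.
move=> defP E12 [r1 [Q1r r1I r1E]] [r2 [Q2r r2I r2E]].
pose r i := match split i with inl j => r1 j | inr j => r2 j end.
exists r; split=> [i|i j|x /defP[Qx|Qx]].
- by apply/defP; rewrite /r; case: (split i) => j; [left | right].
- rewrite -[i]splitK -[j]splitK /r !unsplitK.
  case: (split i) (split j) => [i1|i2] [j1|j2] /=.
  + by move/r1I->.
  + by case/(E12 _ _ (Q1r i1) (Q2r j2)).1.
  + by case/(E12 _ _ (Q1r j1) (Q2r i2)).2.
  + by move/r2I->.
- by have [i Ei] := r1E x Qx; exists (unsplit (inl i)); rewrite /r unsplitK.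
- by have [i Ei] := r2E x Qx; exists (unsplit (inr i)); rewrite /r unsplitK.
Qed.

(** This carries a count of forms over to a count of algebras, [phi] being the algebra attached to a
    form. *)
Lemma class_count_transfer (X Y : Type) (E : X -> X -> Prop)
    (E' : Y -> Y -> Prop) (P : X -> Prop) (Q : Y -> Prop) (phi : Y -> X)
    (N : nat) :
  (forall x y z, E x y -> E y z -> E x z) ->
  (forall y, Q y -> P (phi y)) ->
  (forall y z, Q y -> Q z -> E (phi y) (phi z) <-> E' y z) ->
  (forall x, P x -> exists2 y, Q y & E x (phi y)) ->
  class_count E' Q N -> class_count E P N.
Proof.
move=> Etr PQ EE' surj [r [Qr rI rE]]; exists (phi \o r).
split=> [i|i j /= /EE' h|x /surj[y Qy Exy]]; first exact: PQ.
  by apply: rI; apply: h.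
have [i /EE' Ei] := rE y Qy; exists i; apply: Etr Exy _; exact: Ei.
Qed.

Lemma nonsquare_neq0 (F : fieldType) (n : F) :
  (forall x, x ^+ 2 != n) -> n != 0.
Proof. by move/(_ 0); rewrite expr0n eq_sym. Qed.

Lemma nonsquare_mul_neq1 (F : fieldType) (n : F) :
  (forall x, x ^+ 2 != n) -> forall z, n * z ^+ 2 != 1.
Proof.
move=> n_nonsquare z; have [->|z0] := eqVneq z 0.
  by rewrite expr0n mulr0 eq_sym oner_eq0.
apply: contraNneq (n_nonsquare z^-1) => e.
by apply/eqP/(mulIf (expf_neq0 2 z0)); rewrite e -exprMn mulVf ?expr1n.
Qed.

(** * Squares in finite fields of odd order *)

Section OddFiniteField.

Variable F : finFieldType.
Hypothesis two_neq0 : 2%:R != 0 :> F.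

Lemma eq_oppr0 (x : F) : (x == - x) = (x == 0).
Proof.
by rewrite -addr_eq0 -mulr2n -mulr_natr mulf_eq0 (negPf two_neq0) orbF.
Qed.

(* The square map is two-to-one outside 0. *)
Lemma card_squares : (#|[set x ^+ 2 | x : F]|.*2 = #|F|.+1)%N.
Proof.
pose S := [set x ^+ 2 | x : F].
have fib (y : F) : y \in S :\ 0 -> #|[set x : F | x ^+ 2 == y]| = 2.
  case/setD1P=> y0 /imsetP[x _ yx].
  have -> : [set z : F | z ^+ 2 == y] = [set x; - x].
    by apply/setP=> z; rewrite !inE yx eqf_sqr.
  suff /negPf xN0 : x != 0 by rewrite cards2 eq_oppr0 xN0.
  by apply: contraNneq y0 => x0; rewrite yx x0 expr0n.
have S0 : 0 \in S by apply/imsetP; exists 0; rewrite ?expr0n.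
have cF : #|F| = (\sum_(y in S) #|[set x : F | x ^+ 2 == y]|)%N.
  rewrite -sum1_card (partition_big (fun x : F => x ^+ 2) (mem S)) /=.
    by apply: eq_bigr => y _; rewrite -sum1_card; apply: eq_bigl => x;
      rewrite !inE.
  by move=> x _; apply/imsetP; exists x.
rewrite cF (bigD1 0) //= (eq_bigr (fun=> 2)); last first.
  by move=> y /andP[yS y0]; apply: fib; rewrite in_setD1 y0.
rewrite sum_nat_const.
have -> : [set x : F | x ^+ 2 == 0] = [set 0].
  by apply/setP=> z; rewrite !inE expf_eq0.
rewrite cards1 -/S (cardsD1 0 S) S0.
have -> : #|[pred i in S | i != 0]| = #|S :\ 0|.
  by apply: eq_card => z; rewrite !inE andbC.
by rewrite muln2 doubleD.
Qed.

(** If every element were a square, [card_squares] would give 2q = q + 1, hence q = 1, although 0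
    and 1 differ. *)
Lemma exists_nonsquare : exists n : F, forall x, x ^+ 2 != n.
Proof.
have: [set x ^+ 2 | x : F] != setT.
  apply/eqP=> ST; have := card_squares.
  rewrite ST cardsT => /eqP; rewrite -addnn -addn1 eqn_add2l => /eqP c1.
  have := max_card (pred2 (0 : F) 1).
  by rewrite card2 eq_sym oner_eq0 c1.
rewrite -subTset => /subsetPn[n _ nS]; exists n => x.
by apply: contraNneq nS => <-; apply/imsetP; exists x.
Qed.

(* Pigeonhole: the value sets of [a x^2] and of [c - b y^2] both have more
   than #|F|/2 elements. *)
Lemma binary_form_onto (a b c : F) : a != 0 -> b != 0 ->
  exists x y, a * x ^+ 2 + b * y ^+ 2 = c.
Proof.
move=> a0 b0; pose S := [set x ^+ 2 | x : F].
pose A := [set a * s | s in S]; pose B := [set c - b * s | s in S].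
have cA : #|A| = #|S| by apply: card_imset; apply: mulfI.
have cB : #|B| = #|S| by apply: card_imset => u v /addrI/oppr_inj/(mulfI b0).
have : A :&: B != set0.
  apply: contraTneq isT => AB0; have := max_card (A :|: B).
  rewrite cardsU AB0 cards0 subn0 cA cB addnn card_squares.
  by rewrite ltnn.
case/set0Pn=> z /setIP[/imsetP[_ /imsetP[x _ ->] ->]].
case/imsetP=> _ /imsetP[y _ ->] e; exists x, y; rewrite e; ring.
Qed.

(** The squares and the multiples by [n] of the nonzero squares are disjoint, and by [card_squares]
    their sizes add up to q. *)
Lemma square_or_nonsquare (n x : F) : (forall y, y ^+ 2 != n) -> x != 0 ->
  exists2 y, y != 0 & x = y ^+ 2 \/ x = n * y ^+ 2.
Proof.
move=> nN x0; have n0 : n != 0 := nonsquare_neq0 nN.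
pose S := [set x ^+ 2 | x : F]; pose B := [set n * s | s in S :\ 0].
have S0 : 0 \in S by apply/imsetP; exists 0; rewrite ?expr0n.
have cB : #|B| = #|S :\ 0| by apply: card_imset; apply: mulfI.
have : x \in S :|: B.
  have -> : S :|: B = setT; last by [].
  apply/eqP; rewrite eqEcard subsetT cardsT cardsU.
  have -> : S :&: B = set0.
    apply/setP=> z; rewrite !inE; apply/negP=> /andP[/imsetP[u _ zu]].
    case/imsetP=> w /setD1P[v0 /imsetP[v _ ev]] zv.
    rewrite {}ev in v0 zv; have := nN (u / v).
    by rewrite expr_div_n -zu zv mulfK ?eqxx.
  rewrite cards0 subn0 cB; have := cardsD1 0 S; rewrite S0 => cS.
  by rewrite -ltnS -card_squares -/S cS add1n doubleS -addnn addSn leqnn.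
case/setUP=> [/imsetP[y _ xy]|/imsetP[w /setD1P[_ /imsetP[y _ ->]] xy]].
  by exists y; [apply: contraNneq x0 => y0; rewrite xy y0 expr0n | left].
exists y; last by right.
by apply: contraNneq x0 => y0'; rewrite xy y0' expr0n mulr0.
Qed.

End OddFiniteField.

(** Reduces a claim of nonvanishing to a polynomial identity for [ring]. *)
Lemma eq_neq0 (R : nzRingType) (x y : R) : x = y -> y != 0 -> x != 0.
Proof. by move->. Qed.

(** Certificate for an equality that holds modulo the relation [e = 0]: [c] is the cofactor, and
    [ring] checks the rest. *)
Lemma eq_sub_mul0 (R : pzRingType) (x y c e : R) : e = 0 -> x - y = c * e ->
  x = y.
Proof. by move=> ->; rewrite mulr0 => /subr0_eq. Qed.

(** * Matrices of sizes 2 and 3 given by their entries, so that matrix identities become scalar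
    ones *)

Section ExplicitMatrices.

Variable F : fieldType.

Definition mx2 (a b c d : F) : 'M[F]_2 :=
  \matrix_(i, j) nth 0 (nth [::] [:: [:: a; b]; [:: c; d]] i) j.

Definition mx3 (a b c d e f g h i : F) : 'M[F]_3 :=
  \matrix_(j, k)
    nth 0 (nth [::] [:: [:: a; b; c]; [:: d; e; f]; [:: g; h; i]] j) k.

Lemma mx2P (M : 'M[F]_2) : exists a b c d, M = mx2 a b c d.
Proof.
exists (M 0 0), (M 0 1), (M 1 0), (M 1 1).
by apply/matrixP=> [[[|[|//]] ?] [[|[|//]] ?]];
  rewrite mxE /=; congr (M _ _); apply: val_inj.
Qed.

Lemma mx3P (M : 'M[F]_3) :
  exists a b c d e f g h i, M = mx3 a b c d e f g h i.
Proof.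
pose o0 : 'I_3 := inord 0; pose o1 : 'I_3 := inord 1; pose o2 : 'I_3 := inord 2.
exists (M o0 o0), (M o0 o1), (M o0 o2), (M o1 o0), (M o1 o1), (M o1 o2),
  (M o2 o0), (M o2 o1), (M o2 o2).
by apply/matrixP=> [[[|[|[|//]]] ?] [[|[|[|//]]] ?]];
  rewrite mxE /=; congr (M _ _); apply: val_inj; rewrite /= inordK.
Qed.

Lemma mx2_inj a b c d a' b' c' d' : mx2 a b c d = mx2 a' b' c' d' ->
  [/\ a = a', b = b', c = c' & d = d'].
Proof.
move/matrixP=> e; have := (e 0 0, e 0 1, e 1 0, e 1 1).
by rewrite !mxE /= => -[[[]]].
Qed.

Lemma mx3_inj a b c d e f g h i a' b' c' d' e' f' g' h' i' :
  mx3 a b c d e f g h i = mx3 a' b' c' d' e' f' g' h' i' ->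
  [/\ [/\ a = a', b = b' & c = c'], [/\ d = d', e = e' & f = f']
    & [/\ g = g', h = h' & i = i']].
Proof.
pose o0 : 'I_3 := Ordinal (isT : 0 < 3)%N.
pose o1 : 'I_3 := Ordinal (isT : 1 < 3)%N.
pose o2 : 'I_3 := Ordinal (isT : 2 < 3)%N.
move/matrixP=> E; split; split.
- by have := E o0 o0; rewrite !mxE.
- by have := E o0 o1; rewrite !mxE.
- by have := E o0 o2; rewrite !mxE.
- by have := E o1 o0; rewrite !mxE.
- by have := E o1 o1; rewrite !mxE.
- by have := E o1 o2; rewrite !mxE.
- by have := E o2 o0; rewrite !mxE.
- by have := E o2 o1; rewrite !mxE.
- by have := E o2 o2; rewrite !mxE.
Qed.

Lemma mul_mx2 a b c d a' b' c' d' :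
  mx2 a b c d *m mx2 a' b' c' d' =
  mx2 (a * a' + b * c') (a * b' + b * d') (c * a' + d * c') (c * b' + d * d').
Proof.
by apply/matrixP=> [[[|[|//]] ?] [[|[|//]] ?]];
  rewrite !mxE !big_ord_recl big_ord0 !mxE /= addr0.
Qed.

Lemma mul_mx3 a b c d e f g h i a' b' c' d' e' f' g' h' i' :
  mx3 a b c d e f g h i *m mx3 a' b' c' d' e' f' g' h' i' =
  mx3 (a * a' + b * d' + c * g') (a * b' + b * e' + c * h')
      (a * c' + b * f' + c * i')
      (d * a' + e * d' + f * g') (d * b' + e * e' + f * h')
      (d * c' + e * f' + f * i')
      (g * a' + h * d' + i * g') (g * b' + h * e' + i * h')
      (g * c' + h * f' + i * i').
Proof.
by apply/matrixP=> [[[|[|[|//]]] ?] [[|[|[|//]]] ?]];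
  rewrite !mxE !big_ord_recl big_ord0 !mxE /= addr0 addrA.
Qed.

Lemma tr_mx2 a b c d : (mx2 a b c d)^T = mx2 a c b d.
Proof. by apply/matrixP=> [[[|[|//]] ?] [[|[|//]] ?]]; rewrite !mxE. Qed.

Lemma tr_mx3 a b c d e f g h i :
  (mx3 a b c d e f g h i)^T = mx3 a d g b e h c f i.
Proof.
by apply/matrixP=> [[[|[|[|//]]] ?] [[|[|[|//]]] ?]]; rewrite !mxE.
Qed.

Lemma scale_mx2 k a b c d :
  k *: mx2 a b c d = mx2 (k * a) (k * b) (k * c) (k * d).
Proof. by apply/matrixP=> [[[|[|//]] ?] [[|[|//]] ?]]; rewrite !mxE. Qed.

Lemma scale_mx3 k a b c d e f g h i :
  k *: mx3 a b c d e f g h i =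
  mx3 (k * a) (k * b) (k * c) (k * d) (k * e) (k * f) (k * g) (k * h) (k * i).
Proof.
by apply/matrixP=> [[[|[|[|//]]] ?] [[|[|[|//]]] ?]]; rewrite !mxE.
Qed.

Lemma add_mx2 a b c d a' b' c' d' :
  mx2 a b c d + mx2 a' b' c' d' = mx2 (a + a') (b + b') (c + c') (d + d').
Proof. by apply/matrixP=> [[[|[|//]] ?] [[|[|//]] ?]]; rewrite !mxE. Qed.

Lemma det_mx2 a b c d : \det (mx2 a b c d) = a * d - b * c.
Proof.
rewrite (expand_det_row _ ord0) !big_ord_recl big_ord0 /cofactor !det_mx11.
rewrite !mxE /=; ring.
Qed.

Lemma det_mx3 a b c d e f g h i : \det (mx3 a b c d e f g h i) =
  a * (e * i - f * h) - b * (d * i - f * g) + c * (d * h - e * g).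
Proof.
have minor (j : 'I_3) : cofactor (mx3 a b c d e f g h i) ord0 j =
    (-1) ^+ j * \det (mx2 (nth 0 [:: d; e; f] (bump j 0))
      (nth 0 [:: d; e; f] (bump j 1)) (nth 0 [:: g; h; i] (bump j 0))
      (nth 0 [:: g; h; i] (bump j 1))).
  rewrite /cofactor add0n; congr (_ * \det _).
  by apply/matrixP=> [[[|[|//]] ?] [[|[|//]] ?]]; rewrite !mxE.
rewrite (expand_det_row _ ord0) !big_ord_recl big_ord0 !minor !det_mx2.
rewrite !mxE /=; ring.
Qed.

Lemma mx2_0 : 0 = mx2 0 0 0 0.
Proof. by apply/matrixP=> [[[|[|//]] ?] [[|[|//]] ?]]; rewrite !mxE. Qed.

Lemma mx3_0 : 0 = mx3 0 0 0 0 0 0 0 0 0.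
Proof.
by apply/matrixP=> [[[|[|[|//]]] ?] [[|[|[|//]]] ?]]; rewrite !mxE.
Qed.

Lemma unit_mx2 a b c d : (mx2 a b c d \in unitmx) = (a * d - b * c != 0).
Proof. by rewrite unitmxE det_mx2 unitfE. Qed.

Lemma unit_mx3 a b c d e f g h i : (mx3 a b c d e f g h i \in unitmx) =
  (a * (e * i - f * h) - b * (d * i - f * g) + c * (d * h - e * g) != 0).
Proof. by rewrite unitmxE det_mx3 unitfE. Qed.

End ExplicitMatrices.

(** * Binary and ternary bilinear forms *)

Section BinaryForms.

Variable F : finFieldType.
Hypothesis two_neq0 : 2%:R != 0 :> F.

(** Polarization: if both diagonal entries vanish, the value at (1, 1) is 2b. *)
Lemma binary_form_neq0 (a b d : F) : (a != 0) || (b != 0) || (d != 0) ->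
  exists p q, a * p ^+ 2 + 2%:R * b * p * q + d * q ^+ 2 != 0.
Proof.
have [a0 _|a0] := boolP (a != 0).
  by exists 1, 0; apply: (eq_neq0 _ a0); ring.
have [d0 _|d0] := boolP (d != 0).
  by exists 0, 1; apply: (eq_neq0 _ d0); ring.
rewrite !negbK in a0 d0; rewrite (eqP a0) (eqP d0) orbF => b0.
by exists 1, 1; rewrite !mul0r add0r addr0 !mulr1 mulf_neq0.
Qed.

(* The second row (r, s) is orthogonal to the first one and scaled so as to
   make the determinant 1. *)
Lemma binary_form_diag_value (a b d p q t : F) :
  t = a * p ^+ 2 + 2%:R * b * p * q + d * q ^+ 2 -> t != 0 ->
  exists r s, [/\ p * s - q * r = 1,
    a * p * r + b * (p * s + q * r) + d * q * s = 0 &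
    a * r ^+ 2 + 2%:R * b * r * s + d * s ^+ 2 = (a * d - b ^+ 2) / t].
Proof.
move=> dt t0; exists (- (b * p + d * q) / t), ((a * p + b * q) / t).
by split; rewrite dt; rewrite dt in t0; field.
Qed.

Lemma binary_form_diag (a b d : F) : (a != 0) || (b != 0) || (d != 0) ->
  exists p q r s t, [/\ p * s - q * r = 1, t != 0,
    a * p ^+ 2 + 2%:R * b * p * q + d * q ^+ 2 = t,
    a * p * r + b * (p * s + q * r) + d * q * s = 0 &
    a * r ^+ 2 + 2%:R * b * r * s + d * s ^+ 2 = (a * d - b ^+ 2) / t].
Proof.
case/binary_form_neq0=> p [q t0].
have [r [s [e1 e2 e3]]] := binary_form_diag_value erefl t0.
by exists p, q, r, s; eexists; split; [| exact: t0| reflexivity | |].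
Qed.

(** After diagonalization, [binary_form_onto] finds a vector of value 1. Diagonalizing again from
    this vector leaves the discriminant as the other entry. *)
Lemma binary_form_diag1 (a b d : F) : a * d - b ^+ 2 != 0 ->
  exists p q r s, [/\ p * s - q * r = 1,
    a * p ^+ 2 + 2%:R * b * p * q + d * q ^+ 2 = 1,
    a * p * r + b * (p * s + q * r) + d * q * s = 0 &
    a * r ^+ 2 + 2%:R * b * r * s + d * s ^+ 2 = a * d - b ^+ 2].
Proof.
move=> D0.
have /binary_form_diag : (a != 0) || (b != 0) || (d != 0).
  apply: contraR D0; rewrite !negb_or !negbK => /andP[/andP[/eqP-> /eqP->] _].
  by rewrite mul0r expr0n subr0.
case=> p [q [r [s [t [e1 t0 e2 e3 e4]]]]].
have Dt0 : (a * d - b ^+ 2) / t != 0 by rewrite mulf_neq0 ?invr_eq0.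
have [x [y exy]] := binary_form_onto two_neq0 1 t0 Dt0.
pose P := x * p + y * r; pose Q := x * q + y * s.
have e5 : 1 = a * P ^+ 2 + 2%:R * b * P * Q + d * Q ^+ 2.
  transitivity (x ^+ 2 * (a * p ^+ 2 + 2%:R * b * p * q + d * q ^+ 2) +
    2%:R * x * y * (a * p * r + b * (p * s + q * r) + d * q * s) +
    y ^+ 2 * (a * r ^+ 2 + 2%:R * b * r * s + d * s ^+ 2)).
    by rewrite e2 e3 e4 mulr0 addr0 -exy; ring.
  by rewrite /P /Q; ring.
have [R [S [f1 f2 f3]]] := binary_form_diag_value e5 (oner_neq0 F).
by exists P, Q, R, S; split; rewrite // f3 divr1.
Qed.

End BinaryForms.

Ltac mx3_calc := rewrite !(tr_mx3, mul_mx3, scale_mx3); congr mx3.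

(** * Nonzero ternary bilinear forms up to congruence and scaling *)

Section TernaryForms.

Variable F : finFieldType.
Hypothesis two_neq0 : 2%:R != 0 :> F.

Definition sim3 (M N : 'M[F]_3) : Prop := exists c (g : 'M[F]_3),
  [/\ c != 0, g \in unitmx & N = c *: (g *m M *m g^T)].

Lemma sim3_trans M N P : sim3 M N -> sim3 N P -> sim3 M P.
Proof.
move=> [c [g [c0 gU ->]]] [d [h [d0 hU ->]]]; exists (d * c), (h *m g).
split; rewrite ?mulf_neq0 ?unitmx_mul ?gU ?hU //.
by rewrite -scalemxAr -scalemxAl scalerA trmx_mul !mulmxA.
Qed.

Lemma sim3_sym M N : sim3 M N -> sim3 N M.
Proof.
move=> [c [g [c0 gU ->]]]; exists c^-1, (invmx g).
split; rewrite ?invr_eq0 ?unitmx_inv //.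
rewrite -scalemxAr -scalemxAl scalerA mulVf // scale1r trmx_inv !mulmxA.
by rewrite mulVmx // mul1mx mulmxK // unitmx_tr.
Qed.

(* The form with symmetric part [[a, x, y], [x, d, e], [y, e, f]] and skew part
   k (E_23 - E_32), whose radical is the first coordinate axis. *)
Definition tform (k a x y d e f : F) : 'M[F]_3 :=
  mx3 a x y x d (e + k) y (e - k) f.

Lemma tformP n11 n12 n13 n21 n22 n23 n31 n32 n33 k :
  n12 = n21 -> n13 = n31 -> n23 - n32 = 2%:R * k ->
  exists a x y d e f,
    mx3 n11 n12 n13 n21 n22 n23 n31 n32 n33 = tform k a x y d e f.
Proof.
move=> <- <- ek; exists n11, n12, n13, n22, ((n23 + n32) / 2%:R), n33.
have -> : k = (n23 - n32) / 2%:R by rewrite ek; field.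
by congr mx3; field.
Qed.

(** A skew form in dimension 3 is given by a vector through the cross product, and a nonzero such
    vector spans its radical. Two standard vectors complete it to a basis, chosen according to a
    coordinate that is nonzero; 2 divided by that coordinate scales the skew part to 1. *)
Lemma sim3_tform M : exists (k : bool) a x y d e f,
  sim3 M (tform k%:R a x y d e f).
Proof.
have [m11 [m12 [m13 [m21 [m22 [m23 [m31 [m32 [m33 ->]]]]]]]]] := mx3P M.
pose v1 := m23 - m32; pose v2 := m31 - m13; pose v3 := m12 - m21.
(* The radical (v1, v2, v3) of the skew part becomes the first basis vector. *)
have skew c g : c != 0 -> g \in unitmx ->
    (exists a x y d e f, c *: (g *m mx3 m11 m12 m13 m21 m22 m23 m31 m32 m33 *m
      g^T) = tform 1 a x y d e f) ->
    exists (k : bool) a x y d e f, sim3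
      (mx3 m11 m12 m13 m21 m22 m23 m31 m32 m33) (tform k%:R a x y d e f).
  move=> c0 gU [a [x [y [d [e [f E]]]]]].
  by exists true, a, x, y, d, e, f, c, g.
have [v10|v10] := eqVneq v1 0; last first.
  apply: (skew (2%:R / v1) (mx3 v1 v2 v3 0 1 0 0 0 1)).
  - by rewrite mulf_neq0 ?invr_eq0.
  - by rewrite unit_mx3; apply: (eq_neq0 _ v10); ring.
  rewrite tr_mx3 !mul_mx3 scale_mx3.
  by apply: tformP; rewrite /v2 /v3 /v1; rewrite /v1 in v10; field.
have [v20|v20] := eqVneq v2 0; last first.
  apply: (skew (2%:R / v2) (mx3 v1 v2 v3 0 0 1 1 0 0)).
  - by rewrite mulf_neq0 ?invr_eq0.
  - by rewrite unit_mx3; apply: (eq_neq0 _ v20); ring.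
  rewrite tr_mx3 !mul_mx3 scale_mx3.
  by apply: tformP; rewrite /v2 /v3 /v1; rewrite /v2 in v20; field.
have [v30|v30] := eqVneq v3 0; last first.
  apply: (skew (2%:R / v3) (mx3 v1 v2 v3 1 0 0 0 1 0)).
  - by rewrite mulf_neq0 ?invr_eq0.
  - by rewrite unit_mx3; apply: (eq_neq0 _ v30); ring.
  rewrite tr_mx3 !mul_mx3 scale_mx3.
  by apply: tformP; rewrite /v2 /v3 /v1; rewrite /v3 in v30; field.
exists false; have : m23 - m32 = 2%:R * 0 by rewrite mulr0.
case/(tformP m11 m22 m33 (subr0_eq v30) (esym (subr0_eq v20))).
move=> a [x [y [d [e [f ->]]]]]; exists a, x, y, d, e, f.
exists 1, 1%:M; split; rewrite ?oner_eq0 ?unitmx1 //.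
by rewrite trmx1 mulmx1 mul1mx scale1r.
Qed.

(** The substitutions that preserve the first axis, which is the radical of the skew part when
    [k != 0]; the skew part is multiplied by [c] times the determinant of the lower block. The new
    coefficients are constrained by equations, so that a target form can be prescribed. *)
Lemma sim3_block c m w2 w3 p q r s k a x y d e f k' a' x' y' d' e' f' :
  c != 0 -> m != 0 -> p * s - q * r != 0 ->
  k' = c * k * (p * s - q * r) -> a' = c * m ^+ 2 * a ->
  x' = c * m * (a * w2 + x * p + y * q) ->
  y' = c * m * (a * w3 + x * r + y * s) ->
  d' = c * (a * w2 ^+ 2 + 2%:R * w2 * (x * p + y * q) +
    (d * p ^+ 2 + 2%:R * e * p * q + f * q ^+ 2)) ->
  e' = c * (a * w2 * w3 + w2 * (x * r + y * s) + w3 * (x * p + y * q) +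
    (d * p * r + e * (p * s + q * r) + f * q * s)) ->
  f' = c * (a * w3 ^+ 2 + 2%:R * w3 * (x * r + y * s) +
    (d * r ^+ 2 + 2%:R * e * r * s + f * s ^+ 2)) ->
  sim3 (tform k a x y d e f) (tform k' a' x' y' d' e' f').
Proof.
move=> c0 m0 D0 -> -> -> -> -> -> ->.
exists c, (mx3 m 0 0 w2 p q w3 r s); split=> //.
  by rewrite unit_mx3; apply: (eq_neq0 _ (mulf_neq0 m0 D0)); ring.
by rewrite /tform; mx3_calc; ring.
Qed.

Lemma sim3_sl2 p q r s k a d e f d' e' f' :
  p * s - q * r = 1 ->
  d * p ^+ 2 + 2%:R * e * p * q + f * q ^+ 2 = d' ->
  d * p * r + e * (p * s + q * r) + f * q * s = e' ->
  d * r ^+ 2 + 2%:R * e * r * s + f * s ^+ 2 = f' ->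
  sim3 (tform k a 0 0 d e f) (tform k a 0 0 d' e' f').
Proof.
move=> D1 ed ee ef; apply: (@sim3_block 1 1 0 0 p q r s);
  rewrite ?D1 ?oner_eq0 // ?ed ?ee ?ef; ring.
Qed.

(** Completing the square. The lower block has determinant [a], so that the scaling by [a^-1] which
    makes the pivot 1 leaves [k] unchanged. *)
Lemma sim3_pivot1 k a x y d e f : a != 0 -> exists d' e' f',
  sim3 (tform k a x y d e f) (tform k 1 0 0 d' e' f').
Proof.
move=> a0; do 3 eexists.
by apply: (@sim3_block a^-1 1 (- x) (- (y / a)) a 0 0 1);
  last (by reflexivity); last (by reflexivity); last (by reflexivity);
  rewrite ?invr_eq0 ?oner_eq0 ?mulr1 ?mulr0 ?subr0 //; field.
Qed.

Lemma sim3_perm123 a x y d e f :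
  sim3 (tform 0 a x y d e f) (tform 0 d e x f y a).
Proof.
exists 1, (mx3 0 1 0 0 0 1 1 0 0); split; rewrite ?oner_eq0 //.
  by rewrite unit_mx3; apply: (eq_neq0 _ (oner_neq0 F)); ring.
by rewrite /tform; mx3_calc; ring.
Qed.

Lemma sim3_shear a x y d e f :
  sim3 (tform 0 a x y d e f)
    (tform 0 (a + 2%:R * x + d) (x + d) (y + e) d e f).
Proof.
exists 1, (mx3 1 1 0 0 1 0 0 0 1); split; rewrite ?oner_eq0 //.
  by rewrite unit_mx3; apply: (eq_neq0 _ (oner_neq0 F)); ring.
by rewrite /tform; mx3_calc; ring.
Qed.

(** Polarization again: if the diagonal vanishes, cyclic permutations bring a nonzero off-diagonal
    entry to position (1, 2), and the shear makes twice this entry the pivot. *)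
Lemma sim3_pivot a x y d e f : tform 0 a x y d e f != 0 ->
  exists a' x' y' d' e' f', a' != 0 /\
    sim3 (tform 0 a x y d e f) (tform 0 a' x' y' d' e' f').
Proof.
suff diag a1 x1 y1 d1 e1 f1 :
    (a1 != 0) || (d1 != 0) || (f1 != 0) ->
    exists a' x' y' d' e' f', a' != 0 /\
      sim3 (tform 0 a1 x1 y1 d1 e1 f1) (tform 0 a' x' y' d' e' f').
  move=> M0; have [|] := boolP [|| a != 0, d != 0 | f != 0].
    by rewrite orbA; apply: diag.
  rewrite !negb_or !negbK => /and3P[/eqP a0 /eqP d0 /eqP f0].
  rewrite {}a0 {}d0 {}f0 in M0 *.
  have [x0|x0] := eqVneq x 0; last first.
    do 6 eexists; split; last exact: sim3_shear.
    by apply: (eq_neq0 _ (mulf_neq0 two_neq0 x0)); ring.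
  have [e0|e0] := eqVneq e 0; last first.
    do 6 eexists; split; last first.
      by apply: sim3_trans (sim3_perm123 _ _ _ _ _ _) (sim3_shear _ _ _ _ _ _).
    by apply: (eq_neq0 _ (mulf_neq0 two_neq0 e0)); ring.
  have [y0|y0] := eqVneq y 0; last first.
    do 6 eexists; split; last first.
      apply: sim3_trans (sim3_perm123 _ _ _ _ _ _) _.
      by apply: sim3_trans (sim3_perm123 _ _ _ _ _ _) (sim3_shear _ _ _ _ _ _).
    by apply: (eq_neq0 _ (mulf_neq0 two_neq0 y0)); ring.
  by case/eqP: M0; rewrite x0 e0 y0 mx3_0; congr mx3; ring.
have [a0 _|a0] := boolP (a1 != 0).
  exists a1, x1, y1, d1, e1, f1; split=> //.
  (* Reflexivity of [sim3], as an equivalence followed by its inverse. *)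
  by apply: sim3_trans (sim3_perm123 _ _ _ _ _ _) (sim3_sym (sim3_perm123 _ _ _
    _ _ _)).
have [d0 _|d0] := boolP (d1 != 0).
  by do 6 eexists; split; last exact: sim3_perm123.
move=> f0; do 6 eexists; split; last first.
  by apply: sim3_trans (sim3_perm123 _ _ _ _ _ _) (sim3_perm123 _ _ _ _ _ _).
by [].
Qed.

(** With skew part: [(a, d)] has pivot [a] and discriminant [d] on the last two coordinates; [inr a]
    has nothing there; [None] has rank one there with a nonsquare value, which a scaling can absorb
    only when the pivot is 0; [Some f] pairs an isotropic radical of the skew part with another
    vector. Without skew part: rank 1, rank 2 with discriminant 1 or [n], and rank 3, where scaling
    absorbs the discriminant. *)
Definition rep3 (n : F) (t : bool * F + bool + option bool + 'I_4) : 'M[F]_3 :=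
  match t with
  | inl (inl (inl (a, d))) => tform 1 a%:R 0 0 1 0 d
  | inl (inl (inr a)) => tform 1 a%:R 0 0 0 0 0
  | inl (inr None) => tform 1 1 0 0 n 0 0
  | inl (inr (Some f)) => tform 1 0 1 0 0 0 f%:R
  | inr i => tform 0 1 0 0 (nth 0 [:: 0; 1; n; 1] i) 0 (nth 0 [:: 0; 0; 0; 1] i)
  end.

Variable n : F.
Hypothesis n_nonsquare : forall x, x ^+ 2 != n.

Lemma sim3_rep3_pivot (k : bool) a x y d e f : a != 0 ->
  exists t, sim3 (tform k%:R a x y d e f) (rep3 n t).
Proof.
move=> a0; have [d1 [e1 [f1 Ea]]] := sim3_pivot1 k%:R x y d e f a0.
suff [t Et] : exists t, sim3 (tform k%:R 1 0 0 d1 e1 f1) (rep3 n t).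
  by exists t; apply: sim3_trans Ea Et.
have [|Q0] := boolP ((d1 != 0) || (e1 != 0) || (f1 != 0)); last first.
  move: Q0; rewrite !negb_or !negbK => /andP[/andP[/eqP-> /eqP->] /eqP->].
  exists (if k then inl (inl (inr true)) else inr 0).
  by case: k {Ea} => /=; apply: (@sim3_sl2 1 0 0 1); ring.
case/(binary_form_diag two_neq0)=> p [q [r [s [t [D1 t0 ed ee ef]]]]].
have [D0|D0] := eqVneq (d1 * f1 - e1 ^+ 2) 0.
  have Et := sim3_sl2 k%:R 1 D1 ed ee ef; rewrite D0 mul0r in Et.
  have [z z0 [ez|ez]] := square_or_nonsquare two_neq0 n_nonsquare t0.
    exists (if k then inl (inl (inl (true, 0))) else inr 1).
    apply: sim3_trans Et _; case: k {Ea} => /=;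
      by apply: (@sim3_sl2 z^-1 0 0 z); rewrite ?ez; field.
  exists (if k then inl (inr None) else inr (inord 2)).
  apply: sim3_trans Et _; case: k {Ea} => /=; rewrite ?inordK //=;
    by apply: (@sim3_sl2 z^-1 0 0 z); rewrite ?ez; field.
have [{}p [{}q [{}r [{}s [{}D1 {}ed {}ee {}ef]]]]] :=
  binary_form_diag1 two_neq0 D0.
have Et := sim3_sl2 k%:R 1 D1 ed ee ef.
move: (d1 * f1 - e1 ^+ 2) D0 Et => D D0 Et.
case: k {Ea} Et => /= Et; first by exists (inl (inl (inl (true, D)))).
(* From diag(1, 1, D) a permutation and the scaling by 1/D lead to diag(1, 1/D, 1/D). The last two
   entries have a square discriminant, so they can be replaced by 1, 1/D^2 and then by 1, 1. *)
exists (inr ord_max); apply: sim3_trans Et _ => /=.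
apply: sim3_trans (sim3_perm123 _ _ _ _ _ _) _.
apply: sim3_trans (sim3_perm123 _ _ _ _ _ _) _.
have Db : D^-1 * D^-1 - 0 ^+ 2 != 0 :> F.
  by rewrite expr0n subr0 mulf_neq0 ?invr_eq0.
have [p1 [q1 [r1 [s1 [D1' ed' ee' ef']]]]] := binary_form_diag1 two_neq0 Db.
apply: (@sim3_trans _ (tform 0 1 0 0 D^-1 0 D^-1)).
  by apply: (@sim3_block D^-1 1 0 0 1 0 0 1);
    rewrite ?oner_eq0 ?invr_eq0 ?mulr1 ?mulr0 ?subr0 ?oner_eq0 //; field.
apply: sim3_trans (sim3_sl2 _ _ D1' ed' ee' ef') _.
apply: (@sim3_block 1 1 0 0 1 0 0 D);
  by rewrite ?oner_eq0 // ?mul1r ?mul0r ?subr0 //; field.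
Qed.

Lemma sim3_rep3_isotropic x y d e f :
  exists t, sim3 (tform 1 0 x y d e f) (rep3 n t).
Proof.
have [xy0|xy0] := boolP ((x != 0) || (y != 0)).
  have [d1 [e1 [f1 E1]]] : exists d' e' f',
      sim3 (tform 1 0 x y d e f) (tform 1 0 1 0 d' e' f').
    have [x0|x0] := eqVneq x 0.
      rewrite x0 eqxx /= in xy0 *; do 3 eexists.
      by apply: (@sim3_block 1 1 0 0 0 y^-1 (- y) 0);
        last (by reflexivity); last (by reflexivity); last (by reflexivity);
        rewrite ?oner_eq0 // ?mul0r ?sub0r ?mulrN ?mulVf ?opprK ?oner_eq0 //;
        field.
    do 3 eexists.
    by apply: (@sim3_block 1 1 0 0 x^-1 0 (- y) x);
      last (by reflexivity); last (by reflexivity); last (by reflexivity);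
      rewrite ?oner_eq0 // ?mul0r ?subr0 ?mulVf ?oner_eq0 //; field.
  have E2 : sim3 (tform 1 0 1 0 d1 e1 f1) (tform 1 0 1 0 0 0 f1).
    (* The radical vector of the skew part is isotropic and pairs to 1 with the second vector.
       Adding multiples of it to the other two vectors therefore clears [d1] and [e1]. *)
    by apply: (@sim3_block 1 1 (- d1 / 2%:R) (- e1) 1 0 0 1);
      rewrite ?oner_eq0 // ?mul0r ?subr0 ?mulr1 ?oner_eq0 //; field.
  have [f0|f0] := eqVneq f1 0.
    rewrite f0 in E1 E2; exists (inl (inr (Some false))).
    by rewrite /=; apply: sim3_trans E1 E2.
  exists (inl (inr (Some true))); apply: sim3_trans E1 (sim3_trans E2 _) => /=.
  by apply: (@sim3_block f1^-1 1 0 0 f1 0 0 1);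
    rewrite ?invr_eq0 ?oner_eq0 // ?mul0r ?subr0 ?mulr1 //; field.
move: xy0; rewrite negb_or !negbK => /andP[/eqP-> /eqP->].
have [|Q0] := boolP ((d != 0) || (e != 0) || (f != 0)); last first.
  move: Q0; rewrite !negb_or !negbK => /andP[/andP[/eqP-> /eqP->] /eqP->].
  by exists (inl (inl (inr false))); apply: (@sim3_sl2 1 0 0 1); ring.
case/(binary_form_diag two_neq0)=> p [q [r [s [t [D1 t0 ed ee ef]]]]].
have [D0|D0] := eqVneq (d * f - e ^+ 2) 0.
  have Et := sim3_sl2 1 0 D1 ed ee ef; rewrite D0 mul0r in Et.
  exists (inl (inl (inl (false, 0)))); apply: sim3_trans Et _ => /=.
  (* As the pivot is 0, the scaling by 1/t is compensated by a block of determinant [t], and no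
     square class survives. *)
  by apply: (@sim3_block t^-1 1 0 0 1 0 0 t);
    rewrite ?invr_eq0 ?oner_eq0 // ?mul0r ?subr0 ?mul1r //; field.
have [{}p [{}q [{}r [{}s [{}D1 {}ed {}ee {}ef]]]]] :=
  binary_form_diag1 two_neq0 D0.
by exists (inl (inl (inl (false, d * f - e ^+ 2))));
  apply: sim3_sl2 D1 ed ee ef.
Qed.

Lemma sim3_rep3 M : M != 0 -> exists t, sim3 M (rep3 n t).
Proof.
move=> M0; have [k [a [x [y [d [e [f E]]]]]]] := sim3_tform M.
suff [t Et] : exists t, sim3 (tform k%:R a x y d e f) (rep3 n t).
  by exists t; apply: sim3_trans E Et.
have [a0|/sim3_rep3_pivot] := eqVneq a 0; last exact.
case: k E => E; first by rewrite a0; apply: sim3_rep3_isotropic.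
have /sim3_pivot : tform 0 a x y d e f != 0.
  apply: contraNneq M0 => N0; have [c [g [_ _ ->]]] := sim3_sym E.
  by rewrite [tform _ _ _ _ _ _ _]N0 mulmx0 mul0mx scaler0.
case=> a' [x' [y' [d' [e' [f' [a'0 E']]]]]].
have [t Et] := sim3_rep3_pivot false x' y' d' e' f' a'0.
by exists t; apply: sim3_trans E' Et.
Qed.

(** Congruence and scaling preserve symmetry, so 2k = 0. *)
Lemma sim3_skew0 k a x y d e f a' x' y' d' e' f' :
  sim3 (tform 0 a x y d e f) (tform k a' x' y' d' e' f') -> k = 0.
Proof.
case=> c [g [_ _ E]].
have {}E : tform k a' x' y' d' e' f' = (tform k a' x' y' d' e' f')^T.
  rewrite E [RHS]linearZ /= !trmx_mul trmxK mulmxA; congr (_ *: (_ *m _ *m _)).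
  by rewrite /tform tr_mx3; congr mx3; ring.
move: E; rewrite /tform tr_mx3 => /mx3_inj[_ [_ _ E] _].
have : 2%:R * k = 0 by rewrite -(subrr (e' + k)) {2}E; ring.
by move/eqP; rewrite mulf_eq0 (negPf two_neq0) => /eqP.
Qed.

(* An equivalence preserves the radical of the skew part, hence is block
   triangular. *)
Lemma sim3_block_inv a x y d e f a' x' y' d' e' f' :
  sim3 (tform 1 a x y d e f) (tform 1 a' x' y' d' e' f') ->
  exists c m w2 w3 p q r s, [/\ c != 0, m != 0, c * (p * s - q * r) = 1
    & [/\ a' = c * m ^+ 2 * a,
       x' = c * m * (a * w2 + x * p + y * q),
       y' = c * m * (a * w3 + x * r + y * s)
     & [/\ d' = c * (a * w2 ^+ 2 + 2%:R * w2 * (x * p + y * q) +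
            (d * p ^+ 2 + 2%:R * e * p * q + f * q ^+ 2)),
        e' = c * (a * w2 * w3 + w2 * (x * r + y * s) + w3 * (x * p + y * q) +
            (d * p * r + e * (p * s + q * r) + f * q * s))
      & f' = c * (a * w3 ^+ 2 + 2%:R * w3 * (x * r + y * s) +
            (d * r ^+ 2 + 2%:R * e * r * s + f * s ^+ 2))]]].
Proof.
case=> c [g [c0 gU]].
have [g11 [g12 [g13 [g21 [g22 [g23 [g31 [g32 [g33 eg]]]]]]]]] := mx3P g.
move: gU; rewrite {}eg unit_mx3 => gU.
rewrite /tform tr_mx3 !mul_mx3 scale_mx3.
case/mx3_inj=> [[E11 E12 E13] [E21 E22 E23] [E31 E32 E33]].
(* Subtracting an entry from its transpose isolates the skew part; the positions (1, 2) and (1, 3)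
   then give [D1] and [D2]. *)
have D3 : c * (g22 * g33 - g23 * g32) = 1.
  apply: (mulfI two_neq0); transitivity ((e' + 1) - (e' - 1)); last by ring.
  by rewrite E23 E32; ring.
have D1 : g12 * g23 - g13 * g22 = 0.
  apply: (mulfI (mulf_neq0 two_neq0 c0)); rewrite mulr0 -(subrr x').
  by rewrite {1}E12 {1}E21; ring.
have D2 : g12 * g33 - g13 * g32 = 0.
  apply: (mulfI (mulf_neq0 two_neq0 c0)); rewrite mulr0 -(subrr y').
  by rewrite {1}E13 {1}E31; ring.
have D30 : g22 * g33 - g23 * g32 != 0.
  by apply/eqP=> D0; case/eqP: (oner_neq0 F); rewrite -D3 D0 mulr0.
(* [D1] and [D2] are a homogeneous linear system in [g12], [g13] whose determinant is nonzero by
   [D3]. *)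
have g120 : g12 = 0.
  apply: (mulIf D30); rewrite mul0r.
  transitivity (g22 * (g12 * g33 - g13 * g32) - g32 * (g12 * g23 - g13 * g22)).
    by ring.
  by rewrite D1 D2; ring.
have g130 : g13 = 0.
  apply: (mulIf D30); rewrite mul0r.
  transitivity (g23 * (g12 * g33 - g13 * g32) - g33 * (g12 * g23 - g13 * g22)).
    by ring.
  by rewrite D1 D2; ring.
exists c, g11, g21, g31, g22, g23, g32, g33;
  rewrite {}g120 {}g130 in gU E11 E12 E13 E22 E23 E33 *.
split=> //.
  by apply: contraNneq gU => ->; apply/eqP; ring.
split; [by rewrite E11; ring|by rewrite E12; ring|by rewrite E13; ring|].
split; [by rewrite E22; ring| |by rewrite E33; ring].
by apply: (addIr 1); rewrite E23 -[X in _ = _ + X]D3; ring.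
Qed.

Lemma sim3_pivot_eq0 a x y d e f a' x' y' d' e' f' :
  sim3 (tform 1 a x y d e f) (tform 1 a' x' y' d' e' f') ->
  (a' == 0) = (a == 0).
Proof.
case/sim3_block_inv=> c [m [w2 [w3 [p [q [r [s [c0 m0 _ [-> _ _ _]]]]]]]]].
by rewrite -mulrA mulf_eq0 (negPf c0) mulf_eq0 expf_eq0 (negPf m0).
Qed.

(** The discriminant is multiplied by the square of [c] times the block determinant, and this
    product is 1: hence an invariant in F itself. *)
Lemma sim3_isotropic_inv x y d e f x' y' d' e' f' :
  sim3 (tform 1 0 x y d e f) (tform 1 0 x' y' d' e' f') ->
  x = 0 -> y = 0 ->
  [/\ x' = 0, d' * f' - e' ^+ 2 = d * f - e ^+ 2 &
    d = 0 -> e = 0 -> f = 0 -> d' = 0].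
Proof.
case/sim3_block_inv=> c [m [w2 [w3 [p [q [r [s [c0 m0 D1 [_ ex _]]]]]]]]].
case=> ed ee ef x0 y0; rewrite {}x0 {}y0 in ex ed ee ef; split.
- by rewrite ex; ring.
- rewrite -[RHS]mul1r -(expr1n F 2) -D1 ed ee ef; ring.
- by move=> d0 e0 f0; rewrite ed d0 e0 f0; ring.
Qed.

(** Keeping the pivot 1 forces [w2 = w3 = 0] and c = 1/m^2, so the scaling is by a square: [d'] is a
    value of the old binary form, which separates 1 from [n] in rank one. *)
Lemma sim3_pivot1_inv d e f d' e' f' :
  sim3 (tform 1 1 0 0 d e f) (tform 1 1 0 0 d' e' f') ->
  exists p q, [/\ d' = d * p ^+ 2 + 2%:R * e * p * q + f * q ^+ 2
    & d' * f' - e' ^+ 2 = d * f - e ^+ 2].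
Proof.
case/sim3_block_inv=> c [m [w2 [w3 [p [q [r [s [c0 m0 D1 [ea ex ey]]]]]]]]].
have cm : c * m != 0 by rewrite mulf_neq0.
have w20 : w2 = 0 by apply: (mulfI cm); rewrite mulr0 [RHS]ex; ring.
have w30 : w3 = 0 by apply: (mulfI cm); rewrite mulr0 [RHS]ey; ring.
have -> : c = (m ^+ 2)^-1.
  by apply: (mulIf (expf_neq0 2 m0)); rewrite mulVf ?expf_neq0 // ea mulr1.
rewrite w20 w30 => -[ed ee ef]; exists (p / m), (q / m).
split; first by rewrite ed; field.
have D2 : p * s - q * r = m ^+ 2.
  by apply: (mulfI c0); rewrite D1 ea mulr1.
transitivity ((p * s - q * r) ^+ 2 * (d * f - e ^+ 2) / (m ^+ 2) ^+ 2).
  by rewrite ed ee ef; field.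
by rewrite D2; field.
Qed.

(** The determinant detects rank 3. If [v = 0], the third coordinate does not contribute to the
    leading 2 x 2 minor, which is therefore [u] times a square. *)
Lemma sim3_symmetric_inv u v u' v' :
  sim3 (tform 0 1 0 0 u 0 v) (tform 0 1 0 0 u' 0 v') ->
  (u * v = 0 -> u' * v' = 0) /\ (v = 0 -> exists z, u' = u * z ^+ 2).
Proof.
case=> c [g [c0 gU]].
have [g11 [g12 [g13 [g21 [g22 [g23 [g31 [g32 [g33 ->]]]]]]]]] := mx3P g.
move=> E; split=> [uv0|v0].
  have dt a b : \det (tform 0 1 0 0 a 0 b) = a * b.
    by rewrite /tform det_mx3; ring.
  move/(congr1 determinant): E; rewrite detZ !det_mulmx !dt uv0 => ->; ring.
move: E; rewrite /tform tr_mx3 !mul_mx3 scale_mx3 v0.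
case/mx3_inj=> [[E11 E12 E13] [E21 E22 E23] [E31 E32 E33]].
exists (c * (g11 * g22 - g12 * g21)).
have minor A B C D : 1 = A -> 0 = B -> 0 = C -> u' = D -> u' = A * D - B * C.
  by move=> <- <- <- ->; ring.
by rewrite (minor _ _ _ _ E11 E12 E21 E22); ring.
Qed.

Lemma rep3_symmetric_inj i j : sim3 (rep3 n (inr i)) (rep3 n (inr j)) -> i = j.
Proof.
have n0 : n != 0 := nonsquare_neq0 n_nonsquare.
have nV := nonsquare_mul_neq1 n_nonsquare.
move=> Eij; have Eji := sim3_sym Eij; move: Eij Eji => /=.
move/sim3_symmetric_inv=> [d1 z1] /sim3_symmetric_inv[d2 z2]; move: d1 z1 d2 z2.
case: i j => [[|[|[|[|//]]]] i4] [[|[|[|[|//]]]] j4] /= d1 z1 d2 z2;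
  apply: val_inj => //=; exfalso;
  solve
    [ move/eqP: (d1 (mulr0 _)); rewrite mulr1 oner_eq0 //
    | move/eqP: (d2 (mulr0 _)); rewrite mulr1 oner_eq0 //
    | have [z /eqP] := z1 erefl; rewrite ?mul0r ?mul1r ?oner_eq0 ?(negPf n0) //
        eq_sym ?(negPf (nV z)) ?(negPf (n_nonsquare z)) //
    | have [z /eqP] := z2 erefl; rewrite ?mul0r ?mul1r ?oner_eq0 ?(negPf n0) //
        eq_sym ?(negPf (nV z)) ?(negPf (n_nonsquare z)) // ].
Qed.

Lemma natb_inj (b b' : bool) : (b%:R == 0 :> F) = (b'%:R == 0 :> F) -> b = b'.
Proof. by case: b b' => [] [] //; rewrite eqxx oner_eq0. Qed.

(** The vanishing of the (1, 3) entry forces r = 0, and then f' = c f s^2. *)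
Lemma sim3_hyperbolic_inv f f' :
  sim3 (tform 1 0 1 0 0 0 f) (tform 1 0 1 0 0 0 f') -> f = 0 -> f' = 0.
Proof.
case/sim3_block_inv=> c [m [w2 [w3 [p [q [r [s [c0 m0 _ [_ _ ey]]]]]]]]].
have r0 : r = 0.
  by apply: (mulfI (mulf_neq0 c0 m0)); rewrite mulr0 [RHS]ey; ring.
by case=> _ _ -> ->; rewrite r0; ring.
Qed.

Lemma rep3_inj s t : sim3 (rep3 n s) (rep3 n t) -> s = t.
Proof.
have n0 : n != 0 := nonsquare_neq0 n_nonsquare; have n10 := oner_neq0 F.
have hyper d e f y' d' e' f' :
    sim3 (tform 1 0 0 0 d e f) (tform 1 0 1 y' d' e' f') -> False.
  by move=> E; have [/eqP] := sim3_isotropic_inv E erefl erefl;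
    rewrite (negPf n10).
(* A, B, C, D stand for the four families of [rep3] with skew part, in the order of its definition.
   The pivot, the discriminant and the rank-one value separate them. *)
have AB (b b' : bool) d :
    sim3 (tform 1 b%:R 0 0 0 0 0) (tform 1 b'%:R 0 0 1 0 d) -> False.
  move=> E; have eb := natb_inj (sim3_pivot_eq0 E); rewrite {}eb in E.
  case: b E => /= [/sim3_pivot1_inv[p [q [e1 _]]]|E].
    by case/eqP: n10; rewrite e1; ring.
  have [_ _ h] := sim3_isotropic_inv E erefl erefl.
  by case/eqP: n10; apply: h.
have AC (b : bool) d :
    sim3 (tform 1 b%:R 0 0 1 0 d) (tform 1 1 0 0 n 0 0) -> False.
  move=> E; have eb := @natb_inj true b (sim3_pivot_eq0 E).
  rewrite -{}eb in E; have [p [q [e1 e2]]] := sim3_pivot1_inv E.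
  have d0 : d = 0.
    transitivity (1 * d - 0 ^+ 2); first by ring.
    by rewrite -e2; ring.
  by case/eqP: (n_nonsquare p); rewrite e1 d0; ring.
have BC (b : bool) :
    sim3 (tform 1 b%:R 0 0 0 0 0) (tform 1 1 0 0 n 0 0) -> False.
  move=> E; have eb := @natb_inj true b (sim3_pivot_eq0 E).
  rewrite -{}eb in E; have [p [q [e1 e2]]] := sim3_pivot1_inv E.
  by case/eqP: n0; rewrite e1; ring.
have AD (b : bool) d e f y' d' e' f' :
    sim3 (tform 1 b%:R 0 0 d e f) (tform 1 0 1 y' d' e' f') -> False.
  move=> E; have eb := @natb_inj false b (sim3_pivot_eq0 E).
  by rewrite -{}eb in E; apply: hyper E.
move=> Est; have Ets := sim3_sym Est; move: Est Ets.
have skew u i : sim3 (rep3 n (inr i)) (rep3 n (inl u)) -> False.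
  have [a [x [y [d [e [f ->]]]]]] :
      exists a x y d e f, rep3 n (inl u) = tform 1 a x y d e f.
    by case: u => [[[b d]|b]|[b|]]; do 6 eexists; reflexivity.
  by move/sim3_skew0/eqP; rewrite (negPf n10).
case: s t => [s|i] [t|j]; last first.
- by move=> /rep3_symmetric_inj->.
- by move=> /skew.
- by move=> _ /skew.
case: s t => [[[b d]|b]|[b|]] [[[b' d']|b']|[b'|]].
- move=> E _; have eb := natb_inj (sim3_pivot_eq0 E); rewrite {}eb in E *.
  suff -> : d = d' by [].
  move: E; case: b => /= [/sim3_pivot1_inv[p [q [_ e1]]]|E].
    by transitivity (1 * d - 0 ^+ 2); [ring | rewrite -e1; ring].
  have [_ e1 _] := sim3_isotropic_inv E erefl erefl.
  by transitivity (1 * d - 0 ^+ 2); [ring | rewrite -e1; ring].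
- by move=> _ /AB.
- by move=> /AD.
- by move=> /AC.
- by move=> /AB.
- by move=> /sim3_pivot_eq0/natb_inj->.
- by move=> /AD.
- by move=> /BC.
- by move=> _ /AD.
- by move=> _ /AD.
- move=> /sim3_hyperbolic_inv h1 /sim3_hyperbolic_inv h2.
  suff -> : b = b' by [].
  by apply: natb_inj; apply/eqP/eqP => [/h1|/h2].
- by move=> _ /(@AD true).
- by move=> _ /AC.
- by move=> _ /BC.
- by move=> /(@AD true).
- by [].
Qed.

Lemma class_count_sim3 :
  class_count sim3 (fun M => M != 0) (2 * #|F| + 9).
Proof.
have -> : (2 * #|F| + 9 = #|{: bool * F + bool + option bool + 'I_4}|)%N.
  by rewrite !card_sum card_prod card_option !card_bool card_ord -!addnA.
apply: (class_count_reps (r := rep3 n)).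
- move=> t; apply/eqP; rewrite mx3_0.
  have n10 : 1 <> 0 :> F by apply/eqP; apply: oner_neq0.
  by case: t => [[[[b d]|b]|[b|]]|i] /mx3_inj[[a0 x0 _] [_ _ k0] _];
    rewrite ?add0r in k0.
- exact: rep3_inj.
- exact: sim3_rep3.
Qed.

End TernaryForms.

(** * Pencils of binary bilinear forms *)

Section FormSystems.

Variable F : fieldType.

Definition fsim (d e : nat) (B C : 'I_e -> 'M[F]_d) : Prop :=
  exists (g : 'M_d) (h : 'M_e), [/\ g \in unitmx, h \in unitmx &
    forall k, g *m B k *m g^T = \sum_l h k l *: C l].

Lemma fsim_refl d e (B : 'I_e -> 'M[F]_d) : fsim B B.
Proof.
exists 1%:M, 1%:M; split; rewrite ?unitmx1 // => k.
rewrite mul1mx trmx1 mulmx1 (bigD1 k) //= big1 => [|j jk]; rewrite mxE.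
  by rewrite eqxx scale1r addr0.
by rewrite eq_sym (negPf jk) scale0r.
Qed.

Lemma fsim_trans d e (B C D : 'I_e -> 'M[F]_d) :
  fsim B C -> fsim C D -> fsim B D.
Proof.
move=> [g [h [gU hU E]]] [g' [h' [g'U h'U E']]]; exists (g' *m g), (h *m h').
split; rewrite ?unitmx_mul ?gU ?g'U ?hU ?h'U // => k.
rewrite trmx_mul mulmxA -(mulmxA g') -(mulmxA g') E.
rewrite mulmx_sumr mulmx_suml; under eq_bigr => l _.
  rewrite -scalemxAr -scalemxAl E' scaler_sumr; over.
rewrite exchange_big; apply: eq_bigr => l _; rewrite mxE scaler_suml.
by apply: eq_bigr => j _; rewrite scalerA.
Qed.

Lemma fsim_sym d e (B C : 'I_e -> 'M[F]_d) : fsim B C -> fsim C B.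
Proof.
move=> [g [h [gU hU E]]]; exists (invmx g), (invmx h).
split; rewrite ?unitmx_inv // => k.
have -> : C k = \sum_l invmx h k l *: (g *m B l *m g^T).
  transitivity (\sum_j (invmx h *m h) k j *: C j).
    rewrite mulVmx // (bigD1 k) //= big1 => [|j jk]; rewrite mxE.
      by rewrite eqxx scale1r addr0.
    by rewrite eq_sym (negPf jk) scale0r.
  under [RHS]eq_bigr => l _ do rewrite E scaler_sumr.
  rewrite exchange_big; apply: eq_bigr => j _; rewrite mxE scaler_suml.
  by apply: eq_bigr => l _; rewrite scalerA.
rewrite mulmx_sumr mulmx_suml; apply: eq_bigr => l _.
rewrite -scalemxAr -scalemxAl trmx_inv !mulmxA mulVmx // mul1mx mulmxK //.
by rewrite unitmx_tr.
Qed.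

Definition form_free (d e : nat) (B : 'I_e -> 'M[F]_d) : Prop :=
  forall u : 'I_e -> F, \sum_k u k *: B k = 0 -> forall k, u k = 0.

End FormSystems.

Section Pencils.

Variable F : finFieldType.
Hypothesis two_neq0 : 2%:R != 0 :> F.

Definition bform (a b d k : F) : 'M[F]_2 := mx2 a (b + k) (b - k) d.

Lemma bformP M : exists a b d k, M = bform a b d k.
Proof.
have [a [b [c [d ->]]]] := mx2P M.
by exists a, ((b + c) / 2%:R), d, ((b - c) / 2%:R); congr mx2; field.
Qed.

Lemma bform_inj a b d k a' b' d' k' : bform a b d k = bform a' b' d' k' ->
  [/\ a = a', b = b', d = d' & k = k'].
Proof.
case/mx2_inj=> -> e1 e2 ->; split=> //; apply: (mulfI two_neq0).
  by transitivity ((b + k) + (b - k)); [ring | rewrite e1 e2; ring].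
by transitivity ((b + k) - (b - k)); [ring | rewrite e1 e2; ring].
Qed.

Lemma conj_bform p q r s a b d k :
  mx2 p q r s *m bform a b d k *m (mx2 p q r s)^T =
  bform (a * p ^+ 2 + 2%:R * b * p * q + d * q ^+ 2)
    (a * p * r + b * (p * s + q * r) + d * q * s)
    (a * r ^+ 2 + 2%:R * b * r * s + d * s ^+ 2) (k * (p * s - q * r)).
Proof. by rewrite tr_mx2 !mul_mx2; congr mx2; ring. Qed.

Lemma comb_bform x y a b d k a' b' d' k' :
  x *: bform a b d k + y *: bform a' b' d' k' =
  bform (x * a + y * a') (x * b + y * b') (x * d + y * d') (x * k + y * k').
Proof. by rewrite !scale_mx2 add_mx2; congr mx2; ring. Qed.

Definition pencil (M N : 'M[F]_2) (k : 'I_2) : 'M[F]_2 :=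
  if k == 0 then M else N.

Lemma sum_pencil (h : 'I_2 -> F) M N :
  \sum_k h k *: pencil M N k = h 0 *: M + h 1 *: N.
Proof.
rewrite !big_ord_recl big_ord0 addr0 /pencil /=.
by congr (_ + h _ *: _); apply: val_inj.
Qed.

Lemma pencil_mx2 x y z w M N k :
  \sum_l mx2 x y z w k l *: pencil M N l =
  if k == 0 then x *: M + y *: N else z *: M + w *: N.
Proof.
by rewrite (sum_pencil (mx2 x y z w k)) !mxE; case: k => [[|[|//]] ?].
Qed.

Lemma fsim_pencil p q r s x y z w M N M' N' :
  p * s - q * r != 0 -> x * w - y * z != 0 ->
  mx2 p q r s *m M *m (mx2 p q r s)^T = x *: M' + y *: N' ->
  mx2 p q r s *m N *m (mx2 p q r s)^T = z *: M' + w *: N' ->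
  fsim (pencil M N) (pencil M' N').
Proof.
move=> D0 H0 eM eN; exists (mx2 p q r s), (mx2 x y z w).
by rewrite !unit_mx2 D0 H0; split=> // k; rewrite pencil_mx2 /pencil; case: eqP.
Qed.

Lemma fsim_pencil_inv M N M' N' : fsim (pencil M N) (pencil M' N') ->
  exists p q r s x y z w,
  [/\ p * s - q * r != 0, x * w - y * z != 0,
    mx2 p q r s *m M *m (mx2 p q r s)^T = x *: M' + y *: N' &
    mx2 p q r s *m N *m (mx2 p q r s)^T = z *: M' + w *: N'].
Proof.
case=> g [h []]; have [p [q [r [s ->]]]] := mx2P g.
have [x [y [z [w ->]]]] := mx2P h; rewrite !unit_mx2 => D0 H0 E.
exists p, q, r, s, x, y, z, w; split=> //.
  by have := E 0; rewrite pencil_mx2.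
by have := E 1; rewrite pencil_mx2.
Qed.

Lemma fsim_conj p q r s M N : p * s - q * r != 0 ->
  fsim (pencil M N) (pencil (mx2 p q r s *m M *m (mx2 p q r s)^T)
                            (mx2 p q r s *m N *m (mx2 p q r s)^T)).
Proof.
move=> D0; apply: (@fsim_pencil p q r s 1 0 0 1) => //.
- by rewrite mulr1 mulr0 subr0 oner_eq0.
- by rewrite scale1r scale0r addr0.
- by rewrite scale1r scale0r add0r.
Qed.

(* The pencils containing a skew form. *)
Definition kform (t : F) := pencil (bform 0 0 0 1) (bform 1 0 t 0).

(* The pencils whose symmetric parts are the forms [[t d, b], [b, d]]. *)
Definition nform (t al be : F) := pencil (bform t 0 1 al) (bform 0 1 0 be).

(** The first two equations say that the substitution carries the plane of symmetric parts for [t]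
    into the one for [t'], the last two match the skew parts. The change of basis of the pencil is
    read off from the coordinates (d, b) of the images; its determinant is (ps - qr)(s^2 - t
    r^2). *)
Lemma fsim_nform p q r s t al be t' al' be' :
  p * s - q * r != 0 -> s ^+ 2 - t * r ^+ 2 != 0 ->
  t * p ^+ 2 + q ^+ 2 = t' * (t * r ^+ 2 + s ^+ 2) -> p * q = t' * (r * s) ->
  al * (p * s - q * r) =
    al' * (t * r ^+ 2 + s ^+ 2) + be' * (t * p * r + q * s) ->
  be * (p * s - q * r) = al' * (2%:R * r * s) + be' * (p * s + q * r) ->
  fsim (nform t al be) (nform t' al' be').
Proof.
move=> D0 S0 e1 e2 e3 e4.
apply: (@fsim_pencil p q r s (t * r ^+ 2 + s ^+ 2) (t * p * r + q * s)
  (2%:R * r * s) (p * s + q * r)) => //.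
- by apply: (eq_neq0 _ (mulf_neq0 D0 S0)); ring.
- rewrite conj_bform comb_bform; congr (mx2 _ (_ + _) (_ - _) _).
  + by transitivity (t * p ^+ 2 + q ^+ 2); [ring | rewrite e1; ring].
  + by ring.
  + by rewrite e3; ring.
  + by ring.
  + by rewrite e3; ring.
  + by ring.
- rewrite conj_bform comb_bform; congr (mx2 _ (_ + _) (_ - _) _).
  + by transitivity (2%:R * (p * q)); [ring | rewrite e2; ring].
  + by ring.
  + by rewrite e4; ring.
  + by ring.
  + by rewrite e4; ring.
  + by ring.
Qed.

Lemma fsim_nform_inv t al be t' al' be' :
  fsim (nform t al be) (nform t' al' be') -> exists p q r s,
  [/\ p * s - q * r != 0, s ^+ 2 - t * r ^+ 2 != 0,
    t * p ^+ 2 + q ^+ 2 = t' * (t * r ^+ 2 + s ^+ 2), p * q = t' * (r * s) &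
    al * (p * s - q * r) =
      al' * (t * r ^+ 2 + s ^+ 2) + be' * (t * p * r + q * s) /\
    be * (p * s - q * r) = al' * (2%:R * r * s) + be' * (p * s + q * r)].
Proof.
case/fsim_pencil_inv=> p [q [r [s [x [y [z [w [D0 H0]]]]]]]].
rewrite !conj_bform !comb_bform => /bform_inj[a1 b1 d1 k1].
case/bform_inj=> a2 b2 d2 k2; exists p, q, r, s.
have ex : x = t * r ^+ 2 + s ^+ 2.
  by transitivity (x * 1 + y * 0); [ring | rewrite -d1; ring].
have ey : y = t * p * r + q * s.
  by transitivity (x * 0 + y * 1); [ring | rewrite -b1; ring].
have ez : z = 2%:R * r * s.
  by transitivity (z * 1 + w * 0); [ring | rewrite -d2; ring].
have ew : w = p * s + q * r.
  by transitivity (z * 0 + w * 1); [ring | rewrite -b2; ring].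
split=> //.
- apply: contraNneq H0 => S0; rewrite ex ey ez ew; apply/eqP.
  transitivity ((p * s - q * r) * (s ^+ 2 - t * r ^+ 2)); first by ring.
  by rewrite S0 mulr0.
- rewrite -ex; transitivity (x * t' + y * 0); last by ring.
  by rewrite -a1; ring.
- apply: (mulfI two_neq0); transitivity (z * t' + w * 0).
    by rewrite -a2; ring.
  by rewrite ez; ring.
- by rewrite k1 k2 ex ey ez ew; split; ring.
Qed.

Definition mx_indep (M N : 'M[F]_2) : Prop :=
  forall x y, x *: M + y *: N = 0 -> x = 0 /\ y = 0.

Lemma mx_indep_fsim M N M' N' :
  fsim (pencil M N) (pencil M' N') -> mx_indep M N -> mx_indep M' N'.
Proof.
move=> /fsim_sym[g [h [gU hU E]]] MN x y E0.
have E' : \sum_l ((\row_k (if k == 0 then x else y)) *m h) 0 l *: pencil M N l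
  = 0.
  transitivity (g *m (x *: M' + y *: N') *m g^T); last first.
    by rewrite E0 mulmx0 mul0mx.
  have -> : x *: M' + y *: N' =
      \sum_k (\row_k (if k == 0 then x else y)) 0 k *: pencil M' N' k.
    by rewrite (sum_pencil (fun k => _ 0 k)) !mxE.
  rewrite mulmx_sumr mulmx_suml; under [RHS]eq_bigr => k _.
    rewrite -scalemxAr -scalemxAl E scaler_sumr; over.
  rewrite exchange_big; apply: eq_bigr => l _; rewrite mxE scaler_suml.
  by apply: eq_bigr => k _; rewrite scalerA.
rewrite (sum_pencil (fun l => _ 0 l)) in E'; case/MN: E' => e0 e1.
have h0 : (\row_k (if k == 0 :> 'I_2 then x else y)) *m h = 0.
  apply/rowP=> [[[|[|//]] i2]]; rewrite [RHS]mxE.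
    by rewrite -[RHS]e0; congr (_ _ _); apply: val_inj.
  by rewrite -[RHS]e1; congr (_ _ _); apply: val_inj.
have := congr1 (mulmx^~ (invmx h)) h0; rewrite mulmxK // mul0mx => /rowP xy0.
by split; [have := xy0 0 | have := xy0 1]; rewrite !mxE.
Qed.

Variable n : F.
Hypothesis n_nonsquare : forall x, x ^+ 2 != n.

Definition sqrep (i : 'I_3) : F := nth 0 [:: 0; 1; n] i.

Lemma sqrepP (v : F) : exists i z, z != 0 /\ v = sqrep i * z ^+ 2.
Proof.
have [->|v0] := eqVneq v 0.
  by exists 0, 1; rewrite oner_eq0 mul0r.
have [z z0 [->|->]] := square_or_nonsquare two_neq0 n_nonsquare v0.
  by exists 1, z; rewrite mul1r.
by exists (inord 2), z; rewrite /sqrep inordK.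
Qed.

Lemma sqrep_inj i j :
  (exists z, sqrep j = sqrep i * z ^+ 2) ->
  (exists z, sqrep i = sqrep j * z ^+ 2) -> i = j.
Proof.
have n0 : n != 0 := nonsquare_neq0 n_nonsquare.
have nV := nonsquare_mul_neq1 n_nonsquare.
case: i j => [[|[|[|//]]] i3] [[|[|[|//]]] j3];
  rewrite /sqrep /= => -[z /eqP ez] [w /eqP ew]; apply: val_inj => //=; exfalso;
  move: ez ew; rewrite ?mul0r ?mul1r ?oner_eq0 ?(negPf n0) //
    ?[1 == _]eq_sym ?[n == _]eq_sym ?(negPf (nV _))
    ?(negPf (n_nonsquare _)) // ?oner_eq0 ?(negPf n0) //.
Qed.

Lemma fsim_kform a b d : mx_indep (bform 0 0 0 1) (bform a b d 0) ->
  exists i, fsim (pencil (bform 0 0 0 1) (bform a b d 0)) (kform (sqrep i)).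
Proof.
move=> ind; have abd0 : (a != 0) || (b != 0) || (d != 0).
  apply/negPn/negP; rewrite !negb_or !negbK.
  move=> /andP[/andP[/eqP a0 /eqP b0] /eqP d0].
  have [|_ /eqP] := ind 0 1; last by apply/negP; rewrite oner_eq0.
  by rewrite a0 b0 d0 comb_bform mx2_0; congr mx2; ring.
have [p [q [r [s [t [D1 t0 ed ee ef]]]]]] := binary_form_diag two_neq0 abd0.
(* Scaling the symmetric form by [t] leaves the ratio of its two diagonal entries; rescaling the
   second vector changes this ratio by a square. *)
have [i [z [z0 ez]]] := sqrepP ((a * d - b ^+ 2) / t / t).
exists i; apply: (@fsim_pencil p q (r / z) (s / z) z^-1 0 0 t).
- by apply: (eq_neq0 _ (invr_neq0 z0)); rewrite -[RHS]mul1r -D1; field.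
- by rewrite mulr0 subr0 mulf_neq0 ?invr_eq0.
- rewrite conj_bform comb_bform; congr (mx2 _ (_ + _) (_ - _) _); try by ring.
    by rewrite -[X in _ = X * _ + _]mul1r -D1; field.
  by rewrite -[X in _ = X * _ + _]mul1r -D1; field.
have e4 : (a * d - b ^+ 2) / t = t * sqrep i * z ^+ 2.
  by rewrite -mulrA -ez; field.
rewrite e4 in ef.
rewrite conj_bform comb_bform; congr (mx2 _ (_ + _) (_ - _) _).
- by rewrite ed; ring.
- by transitivity
  ((a * p * r + b * (p * s + q * r) + d * q * s) / z); [field|rewrite ee; ring].
- by ring.
- by transitivity
  ((a * p * r + b * (p * s + q * r) + d * q * s) / z); [field|rewrite ee; ring].
- by ring.
- transitivity ((a * r ^+ 2 + 2%:R * b * r * s + d * s ^+ 2) / z ^+ 2).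
    by field.
  by rewrite ef; field.
Qed.

Lemma fsim_skew_case k a b d k' : mx_indep (bform 0 0 0 k) (bform a b d k') ->
  exists i, fsim (pencil (bform 0 0 0 k) (bform a b d k')) (kform (sqrep i)).
Proof.
move=> ind.
have k0 : k != 0.
  apply/eqP=> k0; have [|/eqP] := ind 1 0; last by rewrite oner_eq0.
  by rewrite k0 comb_bform mx2_0; congr mx2; ring.
have E : fsim (pencil (bform 0 0 0 k) (bform a b d k'))
    (pencil (bform 0 0 0 1) (bform a b d 0)).
  apply: (@fsim_pencil 1 0 0 1 k 0 k' 1).
  - by rewrite mulr1 mulr0 subr0 oner_eq0.
  - by rewrite mulr1 mul0r subr0.
  - by rewrite conj_bform comb_bform; congr mx2; ring.
  - by rewrite conj_bform comb_bform; congr mx2; ring.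
have [i Ei] := fsim_kform (mx_indep_fsim E ind).
by exists i; apply: fsim_trans E Ei.
Qed.

(** The hypothesis makes (d, b) coordinates on the pencil, so Cramer's rule yields the skew part as
    a linear form in them. Dividing the first vector by [z] replaces [v] by its representative
    modulo squares. *)
Lemma fsim_trace_pencil v b1 d1 k1 b2 d2 k2 : d1 * b2 - b1 * d2 != 0 ->
  exists i al be, fsim (pencil (bform (v * d1) b1 d1 k1) (bform (v * d2) b2 d2
    k2))
    (nform (sqrep i) al be).
Proof.
move=> D0; have [i [z [z0 ->]]] := sqrepP v.
exists i, ((k1 * b2 - k2 * b1) / z / (d1 * b2 - b1 * d2)),
  ((d1 * k2 - d2 * k1) / (d1 * b2 - b1 * d2)).
apply: (@fsim_pencil z^-1 0 0 1 d1 (b1 / z) d2 (b2 / z)).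
- by rewrite mulr1 mulr0 subr0 invr_eq0.
- by apply: (eq_neq0 _ (mulf_neq0 D0 (invr_neq0 z0))); field.
- by rewrite conj_bform comb_bform; congr mx2; field; rewrite ?z0 ?D0.
- by rewrite conj_bform comb_bform; congr mx2; field; rewrite ?z0 ?D0.
Qed.

Lemma fsim_normal M N : mx_indep M N ->
  (exists i, fsim (pencil M N) (kform (sqrep i))) \/
  (exists i al be, fsim (pencil M N) (nform (sqrep i) al be)).
Proof.
have [a1 [b1 [d1 [k1 ->]]]] := bformP M; have [a2 [b2 [d2 [k2 ->]]]] :=
  bformP N.
(* The cross product of the two symmetric parts: t1 a + t2 b + t3 d vanishes on the whole pencil. If
   it is 0, the symmetric parts are proportional and some combination of the two forms is skew. *)
move=> ind; pose t1 := d1 * b2 - b1 * d2; pose t2 := a1 * d2 - d1 * a2.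
pose t3 := b1 * a2 - a1 * b2.
have [T0|] := boolP [&& t1 == 0, t2 == 0 & t3 == 0].
  left; case/and3P: T0 => /eqP T1 /eqP T2 /eqP T3.
  have [/and3P[/eqP a0 /eqP b0 /eqP d0]|u0] := boolP [&& a1 == 0,
    b1 == 0 & d1 == 0].
    by rewrite a0 b0 d0 in ind *; apply: fsim_skew_case ind.
  have [l [ea eb ed]] : exists l, [/\ a2 = l * a1, b2 = l * b1 & d2 = l * d1].
    have [a0|a0] := eqVneq a1 0; last first.
      exists (a2 / a1); split; first by field.
        by apply: (mulfI a0); rewrite -(subr0_eq T3); field.
      by apply: (mulfI a0); rewrite (subr0_eq T2); field.
    have [b0|b0] := eqVneq b1 0; last first.
      exists (b2 / b1); split; last by apply: (mulfI b0);
        rewrite -(subr0_eq T1); field.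
        by apply: (mulfI b0); rewrite (subr0_eq T3); field.
      by field.
    have d0 : d1 != 0 by move: u0; rewrite a0 b0 eqxx.
    exists (d2 / d1); split; last by field.
      by apply: (mulfI d0); rewrite -(subr0_eq T2); field.
    by apply: (mulfI d0); rewrite (subr0_eq T1); field.
  have E : fsim (pencil (bform a1 b1 d1 k1) (bform a2 b2 d2 k2))
      (pencil (bform 0 0 0 (k2 - l * k1)) (bform a1 b1 d1 k1)).
    apply: (@fsim_pencil 1 0 0 1 0 1 1 l).
    - by rewrite mulr1 mulr0 subr0 oner_eq0.
    - by rewrite mul0r mul1r sub0r oppr_eq0 oner_eq0.
    - by rewrite conj_bform comb_bform; congr mx2; ring.
    - by rewrite conj_bform comb_bform ea eb ed; congr mx2; ring.
  have [i Ei] := fsim_skew_case (mx_indep_fsim E ind).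
  by exists i; apply: fsim_trans E Ei.
move=> T0; right.
have /(binary_form_diag two_neq0) : (t1 != 0) || (t2 / 2%:R != 0) || (t3 != 0).
  move: T0; rewrite !negb_and orbA mulf_eq0 invr_eq0 (negPf two_neq0) orbF.
  by [].
case=> p [q [r [s [t [D1 t0 ed ee ef]]]]].
set u := (_ / t) in ef.
have D10 : s * p - - r * - q != 0.
  by apply: (eq_neq0 _ (oner_neq0 F)); rewrite -D1; ring.
(* The relation is a trace pairing with the binary form (t1, t2/2, t3). Diagonalizing that form to
   (t, u), and transforming the pencil contragrediently, turns the relation into t a + u d = 0. *)
have tr0 a b d : t1 * a + t2 * b + t3 * d = 0 ->
  a * s ^+ 2 + 2%:R * b * s * - r + d * (- r) ^+ 2 =
  - u / t * (a * (- q) ^+ 2 + 2%:R * b * - q * p + d * p ^+ 2).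
  move=> e0; apply: (mulfI t0).
  transitivity (- u * (a * (- q) ^+ 2 + 2%:R * b * - q * p + d * p ^+ 2));
    last by field.
  apply/eqP; rewrite -subr_eq0; apply/eqP.
  transitivity ((p * s - q * r) ^+ 2 * (t1 * a + t2 * b + t3 * d)); last first.
    by rewrite e0 mulr0.
  rewrite -{1}ed -ef.
  transitivity ((t1 * p ^+ 2 + 2%:R * (t2 / 2%:R) * p * q + t3 * q ^+ 2) *
    (a * s ^+ 2 + 2%:R * b * s * - r + d * (- r) ^+ 2) +
    2%:R * (t1 * p * r + t2 / 2%:R * (p * s + q * r) + t3 * q * s) *
    (- a * s * q + b * (s * p + r * q) - d * r * p) +
    (t1 * r ^+ 2 + 2%:R * (t2 / 2%:R) * r * s + t3 * s ^+ 2) *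
    (a * (- q) ^+ 2 + 2%:R * b * - q * p + d * p ^+ 2)).
    by rewrite ee; ring.
  by field.
have := fsim_conj (bform a1 b1 d1 k1) (bform a2 b2 d2 k2) D10.
rewrite !conj_bform tr0; last by rewrite /t1 /t2 /t3; ring.
rewrite tr0; last by rewrite /t1 /t2 /t3; ring.
set b1' := a1 * s * _ + _ + _; set d1' := a1 * _ + _ + _.
set b2' := a2 * s * _ + _ + _; set d2' := a2 * _ + _ + _ => E.
have D2 : d1' * b2' - b1' * d2' != 0.
  apply: (eq_neq0 _ t0); rewrite -[RHS]mul1r -D1 -ed /b1' /b2' /d1' /d2' /t1
    /t2 /t3.
  by field.
have [i [al [be Ei]]] := fsim_trace_pencil (- u / t) (k1 * (s * p - - r * - q))
  (k2 * (s * p - - r * - q)) D2.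
by exists i, al, be; apply: fsim_trans E Ei.
Qed.

Lemma fsim_nform0 al be : al != 0 -> fsim (nform 0 al be) (nform 0 1 0).
Proof.
(* With p = 1 and q = 0, the conditions for the target (1, 0) are al s = s^2 and be s = 2 r s. *)
move=> al0; apply: (@fsim_nform 1 0 (be / 2%:R) al); try by field.
  by rewrite mul1r mul0r subr0.
by rewrite mul0r subr0 expf_neq0.
Qed.

(* With mu = al + be sqrt t, the map z |-> z / conj z has the value mu / mu'
   at z = mu + conj mu', and at z = sqrt t (mu - conj mu') if the former
   vanishes. *)
Lemma fsim_nform_norm t al be al' be' : t != 0 ->
  al ^+ 2 - t * be ^+ 2 != 0 ->
  al ^+ 2 - t * be ^+ 2 = al' ^+ 2 - t * be' ^+ 2 ->
  fsim (nform t al be) (nform t al' be').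
Proof.
move=> t0 v0 ev.
have {}ev : (al ^+ 2 - t * be ^+ 2) - (al' ^+ 2 - t * be' ^+ 2) = 0.
  by rewrite ev subrr.
have [N0|N0] := eqVneq ((al + al') ^+ 2 - t * (be - be') ^+ 2) 0.
  pose s := t * (be + be'); pose r := al - al'.
  have S0 : s ^+ 2 - t * r ^+ 2 != 0.
    have D4 : - (4%:R * t) * (al ^+ 2 - t * be ^+ 2) != 0.
      by rewrite mulf_neq0 // oppr_eq0 mulf_neq0 // (natrM _ 2 2) mulf_neq0.
    apply: (eq_neq0 _ D4).
    apply/eqP; rewrite -subr_eq0; apply/eqP; transitivity
      (t * ((al + al') ^+ 2 - t * (be - be') ^+ 2) +
       2%:R * t * ((al ^+ 2 - t * be ^+ 2) - (al' ^+ 2 - t * be' ^+ 2))).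
      by rewrite /s /r; ring.
    by rewrite N0 ev; ring.
  apply: (@fsim_nform s (t * r) r s) => //; try by ring.
  - by apply: (eq_neq0 _ S0); ring.
  - by apply: (eq_sub_mul0 (c := - t * (al - al')) ev); rewrite /s /r; ring.
  - by apply: (eq_sub_mul0 (c := - t * (be + be')) ev); rewrite /s /r; ring.
pose s := al + al'; pose r := be - be'.
apply: (@fsim_nform s (t * r) r s) => //; try by ring.
- by apply: (eq_neq0 _ N0); rewrite /s /r; ring.
- by apply: (eq_sub_mul0 (c := al + al') ev); rewrite /s /r; ring.
- by apply: (eq_sub_mul0 (c := be - be') ev); rewrite /s /r; ring.
Qed.

(** For t = 1 the norm splits, and its nonzero zeros fill two lines. A sign change exchanges the
    lines; the substitution with eigenvalues 2x on (1, 1) and 1 on (1, -1) moves along one of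
    them. *)
Lemma fsim_nform1_isotropic al be : al != 0 -> al ^+ 2 = be ^+ 2 ->
  fsim (nform 1 al be) (nform 1 ((1 + 0) / 2%:R) ((1 - 0) / 2%:R)).
Proof.
have diag x : x != 0 ->
    fsim (nform 1 x x) (nform 1 ((1 + 0) / 2%:R) ((1 - 0) / 2%:R)).
  move=> x0; apply: (@fsim_nform (x + 2%:R^-1) (x - 2%:R^-1) (x - 2%:R^-1)
    (x + 2%:R^-1)); try by field.
    by apply: (eq_neq0 _ (mulf_neq0 two_neq0 x0)); field.
  by apply: (eq_neq0 _ (mulf_neq0 two_neq0 x0)); field.
move=> al0 /eqP; rewrite eqf_sqr => /orP[/eqP ea|/eqP ea].
  by rewrite -ea; apply: diag.
apply: (@fsim_trans _ _ _ _ (nform 1 be be)); last first.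
  by apply: diag; rewrite -oppr_eq0 -ea.
by rewrite ea; apply: (@fsim_nform (- 1) 0 0 1); try (by ring);
  rewrite ?mulr1 ?mulr0 ?subr0 ?expr1n ?expr0n ?mulr0 ?subr0 ?oppr_eq0
    ?oner_eq0.
Qed.

Variable w : F -> F * F.
Hypothesis wP : forall v, (w v).1 ^+ 2 - n * (w v).2 ^+ 2 = v.

(** For t = 1 the pair ((1 + v)/2, (1 - v)/2) has norm v, and [None] is the zero skew part, a second
    class of norm 0. For t = n the norm is anisotropic, so that zero is the only skew part of norm 0
    and no extra class occurs. *)
Definition rep2 (u : 'I_3 + (option F + option F + F)) : 'I_2 -> 'M[F]_2 :=
  match u with
  | inl i => kform (sqrep i)
  | inr (inl (inl None)) => nform 0 1 0
  | inr (inl (inl (Some be))) => nform 0 0 be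
  | inr (inl (inr None)) => nform 1 0 0
  | inr (inl (inr (Some v))) => nform 1 ((1 + v) / 2%:R) ((1 - v) / 2%:R)
  | inr (inr v) => nform n (w v).1 (w v).2
  end.

Lemma anisotropic x y : x ^+ 2 - n * y ^+ 2 = 0 -> x = 0 /\ y = 0.
Proof.
move/subr0_eq=> e; have y0 : y = 0.
  apply/eqP/negPn/negP=> y0; case/eqP: (n_nonsquare (x / y)).
  by rewrite expr_div_n e mulfK // expf_neq0.
split=> //; apply/eqP; move/eqP: e.
by rewrite y0 expr0n mulr0 expf_eq0.
Qed.

Lemma fsim_rep2 M N : mx_indep M N -> exists u, fsim (pencil M N) (rep2 u).
Proof.
have n0 : n != 0 := nonsquare_neq0 n_nonsquare.
case/fsim_normal=> [[i Ei]|[i [al [be E]]]]; first by exists (inl i).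
suff [u Eu] : exists u, fsim (nform (sqrep i) al be) (rep2 u).
  by exists u; apply: fsim_trans E Eu.
case: i {E} => [[|[|[|//]]] i3]; rewrite /sqrep /=.
- have [->|al0] := eqVneq al 0.
    by exists (inr (inl (inl (Some be)))); apply: fsim_refl.
  by exists (inr (inl (inl None))); apply: fsim_nform0.
- have [v0|v0] := eqVneq (al ^+ 2 - 1 * be ^+ 2) 0; last first.
    exists (inr (inl (inr (Some (al ^+ 2 - 1 * be ^+ 2))))).
    by apply: fsim_nform_norm; rewrite ?oner_neq0 //; field.
  have ab : al ^+ 2 = be ^+ 2 by rewrite (subr0_eq v0) mul1r.
  have [al0|al0] := eqVneq al 0; last first.
    by exists (inr (inl (inr (Some 0)))); apply: fsim_nform1_isotropic.
  exists (inr (inl (inr None))).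
  have -> : be = 0 by apply/eqP; move/esym/eqP: ab; rewrite al0 expr0n expf_eq0.
  by rewrite al0; apply: fsim_refl.
- exists (inr (inr (al ^+ 2 - n * be ^+ 2))) => /=.
  have [v0|v0] := eqVneq (al ^+ 2 - n * be ^+ 2) 0; last first.
    by apply: fsim_nform_norm; rewrite // wP.
  have [w1 w2] := anisotropic (wP 0); have [al0 be0] := anisotropic v0.
  by rewrite v0 w1 w2 al0 be0; apply: fsim_refl.
Qed.

(** Comparison of the discriminants of the symmetric members: t (ps - qr)^2 = t' w'^2. *)
Lemma fsim_kform_inv t t' : fsim (kform t) (kform t') ->
  exists z, t = t' * z ^+ 2.
Proof.
case/fsim_pencil_inv=> p [q [r [s [x [y [z [w' [D0 H0]]]]]]]].
rewrite !conj_bform !comb_bform => /bform_inj[a1 _ _ _].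
case/bform_inj=> a2 b2 d2 _; exists (w' / (p * s - q * r)).
have ea : p ^+ 2 + t * q ^+ 2 = w'.
  by transitivity (z * 0 + w' * 1); [rewrite -a2; ring | ring].
have ed : r ^+ 2 + t * s ^+ 2 = w' * t'.
  by transitivity (z * 0 + w' * t'); [rewrite -d2; ring | ring].
have eb : p * r + t * q * s = 0.
  by transitivity (z * 0 + w' * 0); [rewrite -b2; ring | ring].
apply: (mulfI (expf_neq0 2 D0)).
transitivity ((p ^+ 2 + t * q ^+ 2) * (r ^+ 2 + t * s ^+ 2) -
  (p * r + t * q * s) ^+ 2); first by ring.
by rewrite ea ed eb; field.
Qed.

(** The coefficients of a member of an [nform] pencil are entries of its symmetric part, so none of
    its nonzero members is skew. *)
Lemma fsim_kform_nform t t' al be : ~ fsim (kform t) (nform t' al be).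
Proof.
case/fsim_pencil_inv=> p [q [r [s [x [y [z [w' [D0 H0]]]]]]]].
rewrite !conj_bform !comb_bform => /bform_inj[_ b1 d1 k1] _.
case/eqP: D0.
have ex : x = 0 by transitivity (x * 1 + y * 0); [ring | rewrite -d1; ring].
have ey : y = 0 by transitivity (x * 0 + y * 1); [ring | rewrite -b1; ring].
by transitivity (1 * (p * s - q * r)); [ring | rewrite k1 ex ey; ring].
Qed.

(** Put N(u, v) = u^2 - t' v^2. Then t' (ps - qr)^2 = (pq - t' rs)^2 - N(p, r) N(q, s), where the
    square vanishes and N(q, s) = - t N(p, r). *)
Lemma fsim_nform_sq t al be t' al' be' :
  fsim (nform t al be) (nform t' al' be') -> exists z, t' = t * z ^+ 2.
Proof.
case/fsim_nform_inv=> p [q [r [s [D0 S0 e1 e2 _]]]].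
exists ((p ^+ 2 - t' * r ^+ 2) / (p * s - q * r)).
apply: (mulfI (expf_neq0 2 D0)).
have eq : q ^+ 2 = t' * s ^+ 2 - t * (p ^+ 2 - t' * r ^+ 2).
  transitivity (t * p ^+ 2 + q ^+ 2 - t * p ^+ 2); first by ring.
  by rewrite e1; ring.
transitivity ((p * q - t' * (r * s)) ^+ 2 -
    (p ^+ 2 - t' * r ^+ 2) * (q ^+ 2 - t' * s ^+ 2)); first by ring.
by rewrite eq e2; field.
Qed.

Lemma fsim_nform_lin0 t al be t' al' be' :
  fsim (nform t al be) (nform t' al' be') -> al' = 0 -> be' = 0 ->
  al = 0 /\ be = 0.
Proof.
case/fsim_nform_inv=> p [q [r [s [D0 _ _ _ [e1 e2]]]]] al0 be0.
by split; apply: (mulIf D0); rewrite ?e1 ?e2 al0 be0; ring.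
Qed.

Lemma fsim_nform0_inv al be al' be' :
  fsim (nform 0 al be) (nform 0 al' be') -> al = 0 -> al' = 0 /\ be = be'.
Proof.
case/fsim_nform_inv=> p [q [r [s [D0 S0 e1 _ [e3 e4]]]]] al0.
have q0 : q = 0.
  have : q ^+ 2 == 0.
    by apply/eqP; transitivity (0 * p ^+ 2 + q ^+ 2); [ring | rewrite e1; ring].
  by rewrite expf_eq0 => /eqP.
rewrite {}al0 {}q0 in D0 e3 e4.
have al'0 : al' = 0.
  by apply: (mulIf S0); transitivity (0 * (p * s - 0 * r)); [rewrite e3|]; ring.
split=> //; apply: (mulIf D0); rewrite e4 al'0; ring.
Qed.

(** The substitutions between two pencils with the same [t] are similitudes of the norm form: (p, q)
    = ep (s, t r) with ep = 1 or -1. With z = s + r sqrt t this makes al + be sqrt t equal, up to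
    sign, to z / conj z times al' + ep be' sqrt t, and the norms agree. *)
Lemma fsim_nform_norm_inv t al be al' be' : t != 0 ->
  fsim (nform t al be) (nform t al' be') ->
  al ^+ 2 - t * be ^+ 2 = al' ^+ 2 - t * be' ^+ 2.
Proof.
move=> t0 /fsim_nform_inv[p [q [r [s [D0 S0 e1 e2 [e3 e4]]]]]].
pose sg := p ^+ 2 - t * r ^+ 2; pose D := p * s - q * r.
have eq2 : q ^+ 2 = t * s ^+ 2 - t * sg.
  transitivity (t * p ^+ 2 + q ^+ 2 - t * p ^+ 2); first by ring.
  by rewrite e1 /sg; ring.
have es : sg * s = D * p.
  transitivity (D * p + r * (p * q - t * (r * s))); first by rewrite /sg /D;
    ring.
  by rewrite e2; ring.
have eqq : sg * q = D * (t * r).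
  transitivity (D * (t * r) + p * (p * q - t * (r * s))).
    by rewrite /sg /D; ring.
  by rewrite e2; ring.
have sg2 : sg ^+ 2 = D ^+ 2.
  apply: (mulfI t0); transitivity ((p * q - t * (r * s)) ^+ 2 -
    sg * (q ^+ 2 - t * s ^+ 2)); last by rewrite /sg /D; ring.
  by rewrite e2 eq2; ring.
have [ep [epsq ep1 ep2]] : exists ep, [/\ ep ^+ 2 = 1,
  p = ep * s & q = ep * (t * r)].
  exists (sg / D); split.
  - by rewrite expr_div_n sg2 divff // expf_neq0.
  - by apply: (mulfI D0); rewrite -/D -es; field.
  - apply: (mulfI D0); rewrite -/D.
    transitivity (sg * (t * r)); last by field.
    have sg0 : sg != 0.
      apply: contraNneq D0 => sg0; move/esym/eqP: sg2.
      by rewrite sg0 expr0n expf_eq0.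
    by apply: (mulfI sg0); rewrite mulrCA eqq; transitivity (D ^+ 2 * (t * r));
      [ring | rewrite -sg2; ring].
have S2 := expf_neq0 2 S0; apply: (mulIf S2).
have e3' : al * ep * (s ^+ 2 - t * r ^+ 2) =
    al' * (t * r ^+ 2 + s ^+ 2) + be' * ep * (2%:R * t * r * s).
  by transitivity (al * (p * s - q * r)); [|rewrite e3]; rewrite ep1 ep2; ring.
have e4' : be * (s ^+ 2 - t * r ^+ 2) =
    al' * ep * (2%:R * r * s) + be' * (s ^+ 2 + t * r ^+ 2).
  transitivity (ep * (be * (p * s - q * r))).
    by transitivity (ep ^+ 2 * be * (s ^+ 2 - t * r ^+ 2));
      [rewrite epsq | rewrite ep1 ep2]; ring.
  rewrite e4; transitivity (al' * ep * (2%:R * r * s) +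
    be' * ep ^+ 2 * (s ^+ 2 + t * r ^+ 2)); first by rewrite ep1 ep2; ring.
  by rewrite epsq; ring.
transitivity ((al * ep * (s ^+ 2 - t * r ^+ 2)) ^+ 2 -
    t * (be * (s ^+ 2 - t * r ^+ 2)) ^+ 2).
  transitivity ((ep ^+ 2 * al ^+ 2 - t * be ^+ 2) * (s ^+ 2 - t * r ^+ 2) ^+ 2).
    by rewrite epsq; ring.
  by ring.
rewrite e3' e4'; transitivity (al' ^+ 2 * (t * r ^+ 2 + s ^+ 2) ^+ 2
   + ep ^+ 2 * be' ^+ 2 * (2%:R * t * r * s) ^+ 2
   - t * (ep ^+ 2 * al' ^+ 2 * (2%:R * r * s) ^+ 2
   + be' ^+ 2 * (s ^+ 2 + t * r ^+ 2) ^+ 2)); first by ring.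
by rewrite epsq; ring.
Qed.

Lemma rep2_inj u v : fsim (rep2 u) (rep2 v) -> u = v.
Proof.
have n0 : n != 0 := nonsquare_neq0 n_nonsquare.
(* Records the square class of [t] for each family, so that [fsim_nform_sq] settles all comparisons
   between different families at once. *)
have tag u' : exists i al be, rep2 (inr u') = nform (sqrep i) al be /\
    i = match u' with inl (inl _) => 0 | inl (inr _) => 1 | _ => inord 2 end.
  case: u' => [[[be|]|[x|]]|x] /=; do 3 eexists; (split; last reflexivity);
    by rewrite /sqrep ?inordK //=; reflexivity.
case: u v => [i|u] [j|v].
- move=> E; congr inl; apply: sqrep_inj; last exact: fsim_kform_inv E.
  exact: fsim_kform_inv (fsim_sym E).
- by have [j [al [be [-> _]]]] := tag v; move/fsim_kform_nform.
- by have [i [al [be [-> _]]]] := tag u; move/fsim_sym/fsim_kform_nform.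
move=> E; have := E.
have [i [al [be [-> ei]]]] := tag u; have [j [al' [be' [-> ej]]]] := tag v.
move=> E'; have {E'} ij : i = j.
  by apply: sqrep_inj; [apply: fsim_nform_sq E' | apply: fsim_nform_sq
    (fsim_sym E')].
rewrite {}ij {}ej in ei; have {tag} /(congr1 val) := ei.
case: u v E {ei al be al' be' i j}
  => [[o|o]|x] [[o'|o']|x']; rewrite /= ?inordK // => E _; congr (inr _).
- congr (inl (inl _)); have E' := fsim_sym E.
  case: o o' E E' => [be|] [be'|] //= E E'.
  + by have [_ ->] := fsim_nform0_inv E erefl.
  + by have [/eqP] := fsim_nform0_inv E erefl; rewrite oner_eq0.
  + by have [/eqP] := fsim_nform0_inv E' erefl; rewrite oner_eq0.
- congr (inl (inr _)); have E' := fsim_sym E.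
  have half (v : F) : (1 + v) / 2%:R = 0 -> (1 - v) / 2%:R = 0 -> False.
    move=> h1 h2; case/eqP: (oner_neq0 F).
    by transitivity ((1 + v) / 2%:R + (1 - v) / 2%:R);
      [field | rewrite h1 h2 addr0].
  case: o o' E E' => [be|] [be'|] //= E E'.
  + congr Some; have := fsim_nform_norm_inv (oner_neq0 F) E => e.
    transitivity (((1 + be) / 2%:R) ^+ 2 - 1 * ((1 - be) / 2%:R) ^+ 2).
      by field.
    by rewrite e; field.
  + by have [h1 h2] := fsim_nform_lin0 E erefl erefl; case: (half be).
  + by have [h1 h2] := fsim_nform_lin0 E' erefl erefl; case: (half be').
- by congr inr; have := fsim_nform_norm_inv n0 E; rewrite !wP.
Qed.

Lemma form_free_pencil M N : form_free (pencil M N) <-> mx_indep M N.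
Proof.
split=> [free x y e|ind u].
  have := free (fun k => if k == 0 then x else y).
  by rewrite sum_pencil => /(_ e) u0; split; [have := u0 0 | have := u0 1].
rewrite sum_pencil => /ind[u0 u1] [[|[|//]] i2].
  by rewrite -[RHS]u0; congr (u _); apply: val_inj.
by rewrite -[RHS]u1; congr (u _); apply: val_inj.
Qed.

Lemma bform_indep a b d k a' b' d' k' :
  (forall x y, x * a + y * a' = 0 -> x * b + y * b' = 0 ->
    x * d + y * d' = 0 -> x * k + y * k' = 0 -> x = 0 /\ y = 0) ->
  mx_indep (bform a b d k) (bform a' b' d' k').
Proof.
move=> ind x y; have -> : 0 = bform 0 0 0 0 by rewrite mx2_0; congr mx2; ring.
by rewrite comb_bform => /bform_inj[]; apply: ind.
Qed.

Lemma rep2_free u : form_free (rep2 u).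
Proof.
have kf t : form_free (kform t).
  apply/form_free_pencil/bform_indep => x y e1 _ _ e2; split.
    by transitivity (x * 1 + y * 0); [ring | rewrite e2].
  by transitivity (x * 0 + y * 1); [ring | rewrite e1].
have nf t al be : form_free (nform t al be).
  apply/form_free_pencil/bform_indep => x y _ e1 e2 _; split.
    by transitivity (x * 1 + y * 0); [ring | rewrite e2].
  by transitivity (x * 0 + y * 1); [ring | rewrite e1].
by case: u => [i|[[[be|]|[v|]]|v]]; [apply: kf | apply: nf..].
Qed.

End Pencils.

Lemma class_count_fsim22 (F : finFieldType) : 2%:R != 0 :> F ->
  class_count (@fsim F 2 2) (@form_free F 2 2) (3 * #|F| + 5).
Proof.
move=> two_neq0; have [n n_nonsquare] := exists_nonsquare two_neq0.
have n0 : n != 0 := nonsquare_neq0 n_nonsquare.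
(* The nondegenerate form x^2 - n y^2 takes every value; [w] chooses one vector for each. *)
have /fin_all_exists[w wP] : forall v : F, exists w : F * F,
    w.1 ^+ 2 - n * w.2 ^+ 2 = v.
  move=> v; have nN0 : - n != 0 by rewrite oppr_eq0.
  have [x [y e]] := binary_form_onto two_neq0 v (oner_neq0 F) nN0.
  by exists (x, y); rewrite -[RHS]e /=; ring.
have -> : (3 * #|F| + 5 = #|{: 'I_3 + (option F + option F + F)}|)%N.
  by rewrite !card_sum !card_option card_ord; ring.
apply: (class_count_reps (r := rep2 n w)).
- by move=> u; apply: rep2_free.
- by move=> u v; apply: rep2_inj.
move=> B Bfree; have eB k : B k = pencil (B 0) (B 1) k.
  by case: k => [[|[|//]] i2]; congr (B _); apply: val_inj.
have [|u [g [h [gU hU E]]]] := fsim_rep2 two_neq0 n_nonsquare wP (M :=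
  B 0) (N := B 1).
  apply/form_free_pencil=> u e; apply: Bfree; rewrite -[RHS]e.
  by apply: eq_bigr => k _; rewrite -eB.
by exists u, g, h; split=> // k; rewrite eB.
Qed.

Lemma class_count_fsim31 (F : finFieldType) : 2%:R != 0 :> F ->
  class_count (@fsim F 3 1) (@form_free F 3 1) (2 * #|F| + 9).
Proof.
move=> two_neq0; have [n n_nonsquare] := exists_nonsquare two_neq0.
apply: (class_count_transfer (phi := fun M _ =>
  M)) (class_count_sim3 two_neq0 n_nonsquare).
- exact: fsim_trans.
- move=> M M0 u; rewrite big_ord1 => /eqP; rewrite scaler_eq0 (negPf M0) orbF.
  by move=> /eqP u0 k; rewrite ord1.
- move=> M N _ _; split=> [[g [h [gU hU /(_ 0)]]]|[c [g [c0 gU ->]]]].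
    have h0 : h 0 0 != 0 by rewrite unitmxE det_mx11 unitfE in hU.
    rewrite big_ord1 => E; exists (h 0 0)^-1, g; split=> //.
      by rewrite invr_eq0.
    by rewrite E scalerA mulVf // scale1r.
  exists g, (c^-1)%:M; split=> //.
    by rewrite unitmxE det_scalar1 unitfE invr_eq0.
  by move=> k; rewrite big_ord1 !ord1 mxE eqxx scalerA mulVf // scale1r.
move=> B Bfree; exists (B 0).
  apply/eqP=> B0; have := Bfree (fun=> 1); rewrite big_ord1 B0 scaler0.
  by move=> /(_ erefl 0)/eqP; rewrite oner_eq0.
exists 1%:M, 1%:M; split; rewrite ?unitmx1 // => k.
by rewrite big_ord1 !ord1 mxE eqxx scale1r mul1mx trmx1 mulmx1.
Qed.

(** * Powers of a nilpotent algebra *)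

Local Notation "x ** y" := (alg_mul _ x y) (at level 40, left associativity).

Section Isomorphisms.

Variable F : fieldType.

Lemma alg_isoI (A B : assocAlg F) (f : {linear A -> B}) :
  injective f -> alg_dim A = alg_dim B ->
  (forall x y : A, f (x ** y) = f x ** f y) -> alg_iso A B.
Proof.
move=> finj dAB fM; exists f => //.
have lk0 : lker (linfun f) == 0%VS.
  by apply/lker0P => x y; rewrite !lfunE; apply: finj.
have lim : limg (linfun f) = fullv.
  apply/eqP; rewrite eqEdim subvf limg_dim_eq;
    first by rewrite /= -/(alg_dim B) -dAB leqnn.
  by rewrite (eqP lk0) capv0.
exists (linfun f)^-1%VF => x.
  by rewrite -(lfunE f) lker0_lfunK.
by rewrite -(lfunE f) limg_lfunVK // lim memvf.
Qed.

Lemma alg_iso_trans (A B C : assocAlg F) :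
  alg_iso A B -> alg_iso B C -> alg_iso A C.
Proof.
move=> [f fB fM] [g gB gM]; exists (g \o f : {linear A -> C}).
  exact: bij_comp.
by move=> x y; rewrite /= fM gM.
Qed.

Lemma alg_iso_sym (A B : assocAlg F) : alg_iso A B -> alg_iso B A.
Proof.
case=> f [g fK gK] fM.
pose gM := GRing.isLinear.Build F B A _ g (can2_linear fK gK).
pose gL : {linear B -> A} := HB.pack g gM.
exists gL; first by exists f.
by move=> x y /=; apply: (can_inj fK); rewrite fM !gK.
Qed.

End Isomorphisms.

Section Powers.

Variables (F : fieldType) (A : assocAlg F).
Implicit Types (U V W : {vspace A}) (x y z : A).

Definition mulv U V : {vspace A} :=
  <<[seq u ** v | u <- vbasis U, v <- vbasis V]>>%VS.

Lemma memv_mulv U V x y : x \in U -> y \in V -> x ** y \in mulv U V.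
Proof.
move=> /coord_vbasis-> /coord_vbasis->; rewrite linear_sumlz.
apply: memv_suml => i _; rewrite linear_sumr; apply: memv_suml => j _.
rewrite linearZl_LR linearZr_LR !memvZ //.
by apply/memv_span/allpairs_f; rewrite mem_nth ?size_tuple.
Qed.

(** Elements of [mulv U V] are only combinations of products, so a property proved for products must
    also be stable under linear combinations. *)
Lemma mulv_ind U V (P : A -> Prop) :
  P 0 -> (forall c x y, P x -> P y -> P (c *: x + y)) ->
  (forall x y, x \in U -> y \in V -> P (x ** y)) ->
  forall z, z \in mulv U V -> P z.
Proof.
move=> P0 PD PM z; rewrite /mulv; set X := [seq _ | _ <- _, _ <- _].
have PX x : x \in X -> P x.
  by case/allpairsP=> [[u v] /= [/vbasis_mem uU /vbasis_mem vV ->]]; apply: PM.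
move/(@coord_span _ _ _ (in_tuple X))->.
elim/big_ind: _ => // [x y Px Py|i _].
  by rewrite -[x]scale1r; apply: PD.
rewrite -[_ *: _]addr0; apply: PD => //; apply/PX.
by rewrite mem_nth // size_tuple.
Qed.

Lemma mulv_subv U V W :
  (forall x y, x \in U -> y \in V -> x ** y \in W) -> (mulv U V <= W)%VS.
Proof.
move=> UVW; apply/subvP; apply: mulv_ind => //; first exact: mem0v.
by move=> c x y Wx Wy; rewrite memvD ?memvZ.
Qed.

(** The index is shifted: [powv k] is A^(k+1), so [powv 1] is A^2 and [powv 0] is A. *)
Fixpoint powv k : {vspace A} := if k is k.+1 then mulv (powv k) fullv else
  fullv.

Lemma powvS k : (powv k.+1 <= powv k)%VS.
Proof.
elim: k => [|k IHk]; first exact: subvf.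
by apply: mulv_subv => x y xk _; rewrite memv_mulv ?memvf // (subvP IHk).
Qed.

Lemma mul_powvr k x y : x \in powv k -> x ** y \in powv k.+1.
Proof. by move=> xk; rewrite memv_mulv ?memvf. Qed.

Lemma mul_powvl k x y : y \in powv k -> x ** y \in powv k.+1.
Proof.
elim: k y => [|k IHk] y; first by rewrite memv_mulv ?memvf.
move: y; apply: mulv_ind; first by rewrite linear0r mem0v.
  by move=> c y z yk zk; rewrite linearDr linearZr_LR memvD ?memvZ.
by move=> u v uk _; rewrite alg_mulA mul_powvr // IHk.
Qed.

Lemma alg_prod0 s : alg_prod (0 : A) s = 0.
Proof. by elim: s => //= y s IHs; rewrite /alg_prod /= linear0l. Qed.

Lemma alg_prodP s c x y :
  alg_prod (c *: x + y) s = c *: alg_prod x s + alg_prod y s.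
Proof.
elim: s x y => //= z s IHs x y.
by rewrite /alg_prod /= linearDl linearZl_LR; apply: IHs.
Qed.

Lemma powv_nilpotent : alg_nilpotent A -> exists n, powv n = 0%VS.
Proof.
case=> n An; exists n; apply/eqP; rewrite -subv0; apply/subvP=> x xn.
(* An element of [powv k] already contains k + 1 factors, so n - k further ones suffice. The case k
   = n with an empty sequence is the claim. *)
suff all k : (k <= n)%N -> forall y, y \in powv k ->
    forall s, size s = (n - k)%N -> alg_prod y s = 0.
  by rewrite memv0; apply/eqP; apply: (all n (leqnn n) x xn [::]);
    rewrite subnn.
elim: k => [_ y _ s|k IHk kn]; first by rewrite subn0; apply: An.
apply: mulv_ind => [s _|c y z IHy IHz s ss|y z yk _ s ss].
- exact: alg_prod0.
- by rewrite alg_prodP IHy // IHz // scaler0 addr0.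
- by apply: (IHk (ltnW kn) y yk (z :: s)); rewrite /= ss subnSK.
Qed.

(** Once two consecutive powers agree, all later ones agree with them, and some later one is 0. *)
Lemma powv_eq0 k : alg_nilpotent A -> (powv k <= powv k.+1)%VS ->
  powv k = 0%VS.
Proof.
case/powv_nilpotent=> n n0 kS; apply/eqP; rewrite -subv0 -n0.
have kn m : (powv k <= powv (m + k))%VS.
  elim: m => [|m IHm]; first exact: subvv.
  apply: subv_trans kS _; apply: mulv_subv => x y xk _.
  by rewrite mul_powvr // (subvP IHm).
apply: subv_trans (kn n) _; elim: k {kS kn} => [|k IHk]; first by rewrite addn0.
by rewrite addnS; apply: subv_trans (powvS _) IHk.
Qed.

Lemma ltn_dim_powv k : alg_nilpotent A -> powv k != 0%VS ->
  (\dim (powv k.+1) < \dim (powv k))%N.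
Proof.
move=> nilA k0; rewrite ltnNge; apply: contra k0 => le_k; apply/eqP.
apply: powv_eq0 => //; rewrite -(geq_leqif (dimv_leqif_sup (powvS k))).
exact: le_k.
Qed.

End Powers.

Lemma leq_dim_powv_iso (F : fieldType) (A B : assocAlg F) k :
  alg_iso A B -> (\dim (powv A k) <= \dim (powv B k))%N.
Proof.
case=> f [g fK gK] fM.
have lk0 : lker (linfun f) == 0%VS.
  by apply/lker0P => x y; rewrite !lfunE; apply: can_inj fK _ _.
rewrite -(limg_dim_eq (f := linfun f)) ?(eqP lk0) ?capv0 //.
apply/dimvS/subvP=> _ /memv_imgP[x xk ->]; rewrite lfunE.
elim: k x xk => [|k IHk]; first by move=> *; apply: memvf.
apply: mulv_ind => [|c x y xk yk|x y xk _]; first by rewrite linear0 mem0v.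
  by rewrite linearP memvD ?memvZ.
by rewrite fM mul_powvr ?IHk.
Qed.

Lemma dim_powv_iso (F : fieldType) (A B : assocAlg F) k :
  alg_iso A B -> \dim (powv A k) = \dim (powv B k).
Proof.
move=> AB; apply/eqP; rewrite eqn_leq !leq_dim_powv_iso //.
exact: alg_iso_sym.
Qed.

(** * Algebras with vanishing triple products *)

Section ClassTwo.

Variables (F : fieldType) (d e : nat).
Implicit Types (B C : 'I_e -> 'M[F]_d).

Definition form_mul B (x y : 'rV[F]_d * 'rV[F]_e) : 'rV[F]_d * 'rV[F]_e :=
  (0, \row_k (x.1 *m B k *m y.1^T) 0 0).

Lemma form_mul_bilinear B :
  bilinear_for (GRing.Scale.Law.clone _ _ *:%R _)
    (GRing.Scale.Law.clone _ _ *:%R _) (form_mul B).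
Proof.
split=> [y|x] a u v; congr (_, _); try by rewrite /= scaler0 addr0.
  by apply/rowP=> k; rewrite [LHS]mxE /= !mulmxDl -!scalemxAl !mxE.
by apply/rowP=> k; rewrite [LHS]mxE linearP /= mulmxDr -scalemxAr !mxE.
Qed.

HB.instance Definition _ B := bilinear_isBilinear.Build F
  ('rV[F]_d * 'rV[F]_e)%type ('rV[F]_d * 'rV[F]_e)%type
  ('rV[F]_d * 'rV[F]_e)%type _ _ (form_mul B) (form_mul_bilinear B).

Lemma form_mulA B x y z :
  form_mul B x (form_mul B y z) = form_mul B (form_mul B x y) z.
Proof.
congr (_, _); apply/rowP=> k; rewrite [LHS]mxE [RHS]mxE /=.
by rewrite trmx0 mulmx0 !mul0mx.
Qed.

Definition form_alg B : assocAlg F :=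
  @AssocAlg F ('rV[F]_d * 'rV[F]_e)%type (form_mul B) (form_mulA B).

Lemma dim_form_alg B : alg_dim (form_alg B) = (d + e)%N.
Proof.
rewrite /alg_dim dimvf; transitivity (dim 'rV[F]_d + dim 'rV[F]_e)%N => //.
by rewrite !dim_matrix -[LHS]/(1 * d + 1 * e)%N !mul1n.
Qed.

Definition form_mx B : 'M[F]_(e, d * d) := \matrix_k mxvec (B k).

Lemma form_free_row_free B : form_free B -> row_free (form_mx B).
Proof.
move=> free; apply: inj_row_free => u uB; apply/rowP=> k; rewrite [RHS]mxE.
apply: (free (u 0)); apply: (can_inj mxvecK); rewrite linear0 -[RHS]uB.
rewrite linear_sum mulmx_sum_row; apply: eq_bigr => i _.
by rewrite rowK linearZ.
Qed.

(** Independence of the forms gives [form_mx] a right inverse, from which the coefficients are read.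
    Thus the square of the algebra is its whole second factor. *)
Lemma form_alg_span B : form_free B -> exists S : 'rV_e -> 'M[F]_d,
  forall z : 'rV_e, (0, z) = \sum_i \sum_j
    S z i j *: (((delta_mx 0 i, 0) : form_alg B) ** (delta_mx 0 j, 0)).
Proof.
case/form_free_row_free/row_freeP=> D BD; exists (fun z =>
  vec_mx (z *m D^T)) => z.
have prodE i j : ((delta_mx 0 i, 0) : form_alg B) ** (delta_mx 0 j, 0) =
    (0, \row_k B k i j).
  congr (_, _); apply/rowP=> k; rewrite [LHS]mxE [RHS]mxE /=.
  by rewrite -rowE trmx_delta -colE !mxE.
pose S := vec_mx (z *m D^T).
have sum0 (I : finType) (E : I -> 'rV[F]_e) :
    \sum_i ((0, E i) : 'rV[F]_d * 'rV[F]_e) = (0, \sum_i E i).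
  by elim/big_rec2: _ => // i x y _ ->; rewrite -[LHS]/(_, _) /= add0r.
under eq_bigr => i _.
  under eq_bigr => j _ do rewrite prodE -[_ *: _]/(_ *: 0, _ *: _) /= scaler0.
  rewrite sum0; over.
rewrite sum0; congr (_, _); apply/rowP=> k.
transitivity ((z *m D^T *m (form_mx B)^T) 0 k).
  by rewrite -mulmxA -trmx_mul BD trmx1 mulmx1.
rewrite mxE (reindex _ (curry_mxvec_bij d d)) summxE.
under [RHS]eq_bigr => i _ do rewrite summxE.
rewrite pair_bigA; apply: eq_bigr => [[i j] _] /=.
by rewrite ![in RHS]mxE !mxE mxvecE.
Qed.

Lemma form_mul_class2 B (x y z : form_alg B) : x ** y ** z = 0.
Proof.
congr (_, _); apply/rowP=> k; rewrite [LHS]mxE [RHS]mxE /=.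
by rewrite !mul0mx mxE.
Qed.

Lemma dim_powv_form_alg B : form_free B -> \dim (powv (form_alg B) 1) = e.
Proof.
move=> /form_alg_span[S spanB].
pose f (z : 'rV[F]_e) : form_alg B := (0, z).
have f_lin : linear f.
  by move=> a u v; rewrite /f -[RHS]/(_ + _, _ + _) /= scaler0 addr0.
pose fM := GRing.isLinear.Build F _ _ _ f f_lin.
pose fL : {linear 'rV[F]_e -> form_alg B} := HB.pack f fM.
have -> : powv (form_alg B) 1 = limg (linfun fL).
  apply/eqP; rewrite eqEsubv; apply/andP; split.
    apply: mulv_subv => x y _ _; apply/memv_imgP.
    by exists (x ** y).2; rewrite ?memvf // lfunE.
  apply/subvP=> _ /memv_imgP[z _ ->]; rewrite lfunE /= /f spanB.
  apply: memv_suml => i _; apply: memv_suml => j _.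
  by apply: memvZ; apply: (@mul_powvr _ (form_alg B) 0); apply: memvf.
rewrite limg_dim_eq; first by rewrite dimvf dim_matrix; apply: mul1n.
apply/eqP; rewrite -subv0; apply/subvP=> z /memv_capP[_].
by rewrite memv_ker lfunE memv0 => /eqP[->].
Qed.

(** Row vectors are multiplied by [g] on the right, so [g] acts on the forms of the target: hence
    the reversed order of [B] and [C]. *)
Lemma fsim_form_alg B C : fsim C B -> alg_iso (form_alg B) (form_alg C).
Proof.
case=> g [h [gU hU E]].
pose f (x : form_alg B) : form_alg C := (x.1 *m g, x.2 *m h^T).
have f_lin : linear f.
  by move=> a u v; rewrite /f -[RHS]/(_ + _, _ + _) /= !mulmxDl -!scalemxAl.
pose fM := GRing.isLinear.Build F _ _ _ f f_lin.
pose fL : {linear form_alg B -> form_alg C} := HB.pack f fM.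
apply: (@alg_isoI _ _ _ fL).
- move=> [x1 x2] [y1 y2] [e1 e2]; congr (_, _).
    by apply: (can_inj (mulmxK gU)).
  by move: e2; apply: (can_inj (mulmxK _)); rewrite unitmx_tr.
- by rewrite !dim_form_alg.
move=> x y; rewrite /= /f /=; congr (_, _); first by rewrite mul0mx.
apply/rowP=> l; rewrite [RHS]mxE /= trmx_mul.
have -> : x.1 *m g *m C l *m (g^T *m y.1^T) = x.1 *m (g *m C l *m g^T) *m y.1^T.
  by rewrite !mulmxA.
rewrite E mulmx_sumr mulmx_suml summxE [LHS]mxE; apply: eq_bigr => k _.
by rewrite -scalemxAr -scalemxAl [RHS]mxE [X in X * _ = _]mxE [X in _ * X =
  _]mxE mulrC.
Qed.

(** An isomorphism maps the square, which is the second factor, into the second factor, hence is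
    block triangular. Its diagonal blocks provide [g] and [h]; the remaining block has no effect on
    products, which depend on first components only. *)
Lemma form_alg_iso B C : form_free B ->
  alg_iso (form_alg B) (form_alg C) -> fsim C B.
Proof.
case/form_alg_span=> S spanB [f [f' fK f'K] fM].
have f01 (z : 'rV_e) : (f (0, z)).1 = 0.
  have fst_sum (I : finType) (E : I -> form_alg C) :
      (\sum_i E i).1 = \sum_i (E i).1.
    by elim/big_rec2: _ => // i x y _ <-.
  rewrite spanB linear_sum fst_sum big1 // => i _.
  rewrite linear_sum fst_sum big1 // => j _.
  by rewrite linearZ /= fM /= scaler0.
pose f1 (v : 'rV[F]_d) : 'rV[F]_d := (f (v, 0)).1.
pose f2 (z : 'rV[F]_e) : 'rV[F]_e := (f (0, z)).2.
have f1_lin : linear f1.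
  move=> a u v; rewrite /f1 -[RHS]/((a *: f (u, 0) + f (v, 0)).1) -linearP.
  by congr (f _).1; congr (_, _); rewrite /= scaler0 addr0.
have f2_lin : linear f2.
  move=> a u v; rewrite /f2 -[RHS]/((a *: f (0, u) + f (0, v)).2) -linearP.
  by congr (f _).2; congr (_, _); rewrite /= scaler0 addr0.
pose f1M := GRing.isLinear.Build F _ _ _ f1 f1_lin.
pose f1L : {linear 'rV[F]_d -> 'rV[F]_d} := HB.pack f1 f1M.
pose f2M := GRing.isLinear.Build F _ _ _ f2 f2_lin.
pose f2L : {linear 'rV[F]_e -> 'rV[F]_e} := HB.pack f2 f2M.
have f1E v : v *m lin1_mx f1L = f1 v by rewrite mul_rV_lin1.
have f2E z : z *m lin1_mx f2L = f2 z by rewrite mul_rV_lin1.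
have hU : lin1_mx f2L \in unitmx.
  rewrite -row_free_unit; apply: inj_row_free => z; rewrite f2E => z0.
  have : f (0, z) = f 0.
    by rewrite linear0 [LHS]surjective_pairing f01 -/(f2 z) z0.
  by move/(can_inj fK)=> [].
have gU : lin1_mx f1L \in unitmx.
  rewrite -row_free_unit; apply: inj_row_free => v; rewrite f1E => v0.
  pose w := (f (v, 0)).2 *m invmx (lin1_mx f2L).
  have : f (v, 0) = f (0, w).
    rewrite [LHS]surjective_pairing [RHS]surjective_pairing f01 -/(f1 v) v0.
    by rewrite -/(f2 w) -f2E mulmxKV.
  by move/(can_inj fK)=> [].
exists (lin1_mx f1L), (lin1_mx f2L)^T; split; rewrite ?unitmx_tr // => l.
apply/matrixP=> i j.
pose bi : form_alg B := (delta_mx 0 i, 0).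
pose bj : form_alg B := (delta_mx 0 j, 0).
have key : (f (bi ** bj)).2 0 l =
    ((delta_mx 0 i : 'rV_d) *m (\sum_k (lin1_mx f2L)^T l k *: B k) *m
      (delta_mx 0 j : 'rV_d)^T) 0 0.
  rewrite -[bi ** bj]/(0, _) -/(f2 _) -f2E [LHS]mxE mulmx_sumr mulmx_suml
    summxE.
  apply: eq_bigr => k _; rewrite -scalemxAr -scalemxAl [RHS]mxE mulrC.
  by rewrite [X in _ * X = _]mxE [X in _ = X * _]mxE.
move: key; rewrite fM [LHS]mxE -/(f1 _) -/(f1 _) -!f1E trmx_mul.
rewrite !mulmxA -2!(mulmxA (delta_mx 0 i)) -!rowE trmx_delta -!colE.
have cr (M : 'M[F]_d) : col j (row i M) 0 0 = M i j by rewrite !mxE.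
have rc (M : 'M[F]_d) : row i (col j M) 0 0 = M i j by rewrite !mxE.
by rewrite -row_mul cr rc.
Qed.

End ClassTwo.

(** * Classification and count of the algebras with vanishing triple products *)

Definition alg_class2 (F : fieldType) (A : assocAlg F) : Prop :=
  forall x y z : A, x ** y ** z = 0.

Section ClassTwoCount.

Variable F : fieldType.

Lemma form_free_leq d e (B : 'I_e -> 'M[F]_d) : form_free B -> (e <= d * d)%N.
Proof. by move/form_free_row_free/eqP=> <-; apply: rank_leq_col. Qed.

Lemma form_alg_complete (A : assocAlg F) (d e : nat) :
  alg_class2 A -> \dim (powv A 1) = e -> alg_dim A = (d + e)%N ->
  exists B : 'I_e -> 'M[F]_d, form_free B /\ alg_iso A (form_alg B).
Proof.
move=> A2 de dA; set U := powv A 1 in de.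
have dC : \dim U^C = d by rewrite dimv_compl -/(alg_dim A) dA de addnK.
subst d; subst e.
pose X := vbasis U^C; pose Y := vbasis U.
(* Structure constants on a complement of A^2; products with a factor in A^2 vanish, so these
   determine the algebra. *)
pose B (k : 'I_(\dim U)) : 'M_(\dim U^C) :=
  \matrix_(i, j) coord Y k (X`_i ** X`_j).
pose f (x : form_alg B) : A := \sum_i x.1 0 i *: X`_i + \sum_k x.2 0 k *: Y`_k.
have f_lin : linear f.
  move=> a u v; rewrite /f scalerDr addrACA !scaler_sumr -!big_split /=.
  by congr (_ + _); apply: eq_bigr => i _; rewrite !mxE scalerDl scalerA.
pose fM := GRing.isLinear.Build F _ _ _ f f_lin.
pose fL : {linear form_alg B -> A} := HB.pack f fM.
have XU (x : 'rV[F]_(\dim U^C)) : \sum_i x 0 i *: X`_i \in (U^C)%VS.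
  apply: memv_suml => i _; apply/memvZ/vbasis_mem.
  by rewrite mem_nth // size_tuple.
have YU (x : 'rV[F]_(\dim U)) : \sum_k x 0 k *: Y`_k \in U.
  apply: memv_suml => i _; apply/memvZ/vbasis_mem.
  by rewrite mem_nth // size_tuple.
have mulUr x y : y \in U -> x ** y = 0.
  move: y; apply: mulv_ind; first by rewrite linear0r.
    by move=> c y z y0 z0; rewrite linearDr linearZr_LR y0 z0 scaler0 addr0.
  by move=> y z _ _; rewrite alg_mulA A2.
have mulUl x y : x \in U -> x ** y = 0.
  move: x; apply: mulv_ind; first by rewrite linear0l.
    by move=> c x z x0 z0; rewrite linearDl linearZl_LR x0 z0 scaler0 addr0.
  by move=> x z _ _; rewrite A2.
have finj : injective fL.
  apply: raddf_inj => -[x z] /=; rewrite /f /= => e0.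
  have x0 : \sum_i x 0 i *: X`_i = 0.
    apply/eqP; rewrite -memv0 -(capv_compl U) memv_cap XU andbT.
    by move/eqP: e0; rewrite addr_eq0 => /eqP->; rewrite memvN.
  rewrite x0 add0r in e0; congr (_, _); apply/rowP=> i; rewrite [RHS]mxE.
    exact: (freeP (basis_free (vbasisP _)) (x 0) x0 i).
  exact: (freeP (basis_free (vbasisP _)) (z 0) e0 i).
have fmul (x y : form_alg B) : fL (x ** y) = fL x ** fL y.
  rewrite /= /f /= big1 => [|i _]; last by rewrite mxE scale0r.
  rewrite add0r linearDl linearDr (mulUl _ _ (YU _)) addr0 (mulUr _ _ (YU _))
    addr0.
  set a := \sum_i x.1 0 i *: _; set b := \sum_i y.1 0 i *: _.
  have abU : a ** b \in U by rewrite memv_mulv ?memvf.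
  rewrite [RHS](coord_vbasis abU); apply: eq_bigr => k _; congr (_ *: _).
  rewrite [LHS]mxE /a /b linear_sumlz linear_sum -mulmxA mxE.
  apply: eq_bigr => i _; rewrite linearZl_LR linearZ /=; congr (_ * _).
  rewrite linear_sumr linear_sum mxE; apply: eq_bigr => j _.
  by rewrite linearZr_LR linearZ /= !mxE mulrC.
have dimAB : alg_dim (form_alg B) = alg_dim A by rewrite dim_form_alg dA.
have isoBA : alg_iso (form_alg B) A by apply: (alg_isoI finj).
exists B; split; last exact: alg_iso_sym.
(* A linear relation between the forms is a functional that kills all products of complement
   vectors, hence all of A^2; evaluating it at the basis of A^2 shows that its coefficients are
   0. *)
move=> u uB; pose phi (y : A) : F^o := \sum_k u k * coord Y k y.
have phi_lin : linear phi.
  move=> c y z; rewrite /phi scaler_sumr -big_split; apply: eq_bigr => k _.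
  by rewrite linearP /= mulrDr mulrCA.
pose phiM := GRing.isLinear.Build F _ _ _ phi phi_lin.
pose phiL : {linear A -> F^o} := HB.pack phi phiM.
have phiX (i j : 'I_(\dim U^C)) : phi (X`_i ** X`_j) = 0.
  have := congr1 (fun M : 'M_(\dim U^C) => M i j) uB.
  rewrite summxE [RHS]mxE => <-; apply: eq_bigr => k _.
  by rewrite !mxE.
have phiU y : y \in U -> phi y = 0.
  move: y; apply: mulv_ind; first exact: (linear0 phiL).
    by move=> c y z y0 z0; rewrite phi_lin y0 z0 scaler0 addr0.
  move=> y z _ _.
  have /memv_addP[y1 /coord_vbasis y1C [y2 y2U ->]] : y \in (U^C + U)%VS.
    by rewrite addvC addv_complf memvf.
  have /memv_addP[z1 /coord_vbasis z1C [z2 z2U ->]] : z \in (U^C + U)%VS.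
    by rewrite addvC addv_complf memvf.
  rewrite linearDl linearDr (mulUl _ _ y2U) addr0 (mulUr _ _ z2U) addr0 y1C z1C.
  rewrite linear_sumlz -[LHS]/(phiL _) linear_sum big1 // => i _.
  rewrite linearZl_LR linear_sumr linearZ linear_sum big1 => [|j _];
    first exact: scaler0.
  by rewrite linearZr_LR linearZ /= phiX; apply: scaler0.
move=> k; have Yk : Y`_k \in U by apply/vbasis_mem; rewrite mem_nth ?size_tuple.
rewrite -(phiU _ Yk) /phi (bigD1 k) //= big1 => [|j jk].
  by rewrite coord_free ?(basis_free (vbasisP _)) // eqxx mulr1 addr0.
by rewrite coord_free ?(basis_free (vbasisP _)) // eq_sym (negPf jk) mulr0.
Qed.

Lemma class_count_class2 d e N :
  class_count (@fsim F d e) (@form_free F d e) N ->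
  class_count (@alg_iso F) (fun A =>
    [/\ alg_dim A = (d + e)%N, alg_class2 A & \dim (powv A 1) = e]) N.
Proof.
apply: (class_count_transfer (phi := @form_alg F d e)).
- exact: alg_iso_trans.
- move=> B Bfree; split; first exact: dim_form_alg.
    exact: form_mul_class2.
  exact: dim_powv_form_alg.
- move=> B C Bf Cf; split=> [/(form_alg_iso Bf)/fsim_sym //|BC].
  exact/fsim_form_alg/fsim_sym.
move=> A [dA A2 eA]; have [B [Bf AB]] := form_alg_complete A2 eA dA.
by exists B.
Qed.

Lemma alg_class2_iso (A B : assocAlg F) :
  alg_iso A B -> alg_class2 A -> alg_class2 B.
Proof.
move=> /alg_iso_sym[f [g fK gK] fM] A2 x y z; apply: (can_inj fK).
by rewrite !fM A2 linear0.
Qed.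

Lemma alg_class2_nilpotent (A : assocAlg F) : alg_class2 A -> alg_nilpotent A.
Proof. by move=> A2; exists 2 => x [|y [|z [|//]]] // _; apply: A2. Qed.

Lemma class_count_fsim_0 d :
  class_count (@fsim F d 0) (@form_free F d 0) 1.
Proof.
rewrite -card_unit; apply: (class_count_reps (r := fun _ _ => 0)).
- by move=> _ u _ [].
- by move=> [] [].
by move=> B _; exists tt, 1%:M, 1%:M; split; rewrite ?unitmx1 // => [[]].
Qed.

End ClassTwoCount.

Lemma class_count_class2_dim4 (F : finFieldType) : 2%:R != 0 :> F ->
  class_count (@alg_iso F) (fun A => alg_dim A = 4%N /\ alg_class2 A)
    (5 * #|F| + 15).
Proof.
move=> two_neq0.
pose D e A := [/\ alg_dim A = 4%N, @alg_class2 F A & \dim (powv A 1) = e].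
have D_iso e e' A B : D e A -> D e' B -> e != e' ->
    ~ alg_iso A B /\ ~ alg_iso B A.
  move=> [_ _ eA] [_ _ eB] ne; split=> /(dim_powv_iso 1); rewrite eA eB => ee.
    by rewrite ee eqxx in ne.
  by rewrite ee eqxx in ne.
have c0 : class_count (@alg_iso F) (D 0) 1.
  exact: (class_count_class2 (class_count_fsim_0 F 4)).
have c1 := class_count_class2 (class_count_fsim31 two_neq0).
have c2 := class_count_class2 (class_count_fsim22 two_neq0).
have -> : (5 * #|F| + 15 = 1 + ((2 * #|F| + 9) + (3 * #|F| + 5)))%N by ring.
apply: (class_count_split (Q1 := D 0) (Q2 := fun A => D 1 A \/ D 2 A)) c0 _.
- move=> A; split=> [[dA A2]|]; last by case=> [[]|[[]|[]]].
  have le4 : (\dim (powv A 1) <= 4)%N by rewrite -[X in (_ <= X)%N]dA dimvS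
    ?subvf.
  have [|B [Bf _]] := form_alg_complete (d := 4 - \dim (powv A 1)) A2 erefl.
    by rewrite dA subnK.
  move: (form_free_leq Bf) le4.
  rewrite /D; move: (\dim _) => [|[|[|[|[|]]]]] //= _ _.
    by left.
  - by right; left.
  - by right; right.
- by move=> A B hA [hB|hB]; apply: D_iso hA hB _.
apply: (class_count_split (Q1 := D 1) (Q2 := D 2)) c1 c2 => //.
by move=> A B hA hB; apply: D_iso hA hB _.
Qed.

(** * Algebras with a nonzero cube *)

Section CubeAlgebras.

Variable F : fieldType.

(** One formula for both shapes: k = 1 makes the last basis vector the fourth power of the first, k
    = 0 detaches it. Associativity rests on kb = kg = 0. *)
Definition cube_mul (k b g : F) (u v : F^o * F^o * F^o * F^o) :
    F^o * F^o * F^o * F^o :=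
  let: (a, s, t, c) := u in let: (a', s', t', c') := v in
  (0, a * a', a * s' + s * a' + b * c * a' + g * c * c',
   k * (a * t' + s * s' + t * a')).

Lemma cube_mul_bilinear k b g :
  bilinear_for (GRing.Scale.Law.clone _ _ *:%R _)
    (GRing.Scale.Law.clone _ _ *:%R _) (cube_mul k b g).
Proof.
have scaleE (x y : F) : x *: (y : F^o) = x * y by [].
by split=> [[[[a s] t] c]|[[[a s] t] c]] l [[[a1 s1] t1] c1] [[[a2 s2] t2] c2];
  congr (_, _, _, _); rewrite /= !scaleE; ring.
Qed.

HB.instance Definition _ k b g := bilinear_isBilinear.Build F
  (F^o * F^o * F^o * F^o)%type (F^o * F^o * F^o * F^o)%type
  (F^o * F^o * F^o * F^o)%type _ _ (cube_mul k b g) (cube_mul_bilinear k b g).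

Lemma cube_mulA k b g : k * b = 0 -> k * g = 0 -> forall x y z,
  cube_mul k b g x (cube_mul k b g y z) = cube_mul k b g (cube_mul k b g x y) z.
Proof.
move=> kb0 kg0 [[[a s] t] c] [[[a1 s1] t1] c1] [[[a2 s2] t2] c2].
congr (_, _, _, _).
- by rewrite /=; ring.
- rewrite /=; transitivity (a * (a1 * a2) + k * g * c * (a1 * t2 + s1 * s2 + t1
    * a2)).
    by ring.
  transitivity (a * (a1 * a2) + k * b * a2 * (a * t1 + s * s1 + t * a1) +
    k * g * c2 * (a * t1 + s * s1 + t * a1)); last by ring.
  by rewrite kb0 kg0; ring.
- rewrite /=; transitivity (k * (a * a1 * s2 + (a * s1 + s * a1) * a2) +
    k * b * c1 * a * a2 + k * g * a * c1 * c2).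
    by ring.
  transitivity (k * (a * a1 * s2 + (a * s1 + s * a1) * a2) +
    k * b * c * a1 * a2 + k * g * c * c1 * a2); last by ring.
  by rewrite kb0 kg0; ring.
Qed.

Definition cube_k (o : option (bool * bool)) : F := (o == None)%:R.
Definition cube_b (o : option (bool * bool)) : F :=
  (if o is Some o then o.1 else false)%:R.
Definition cube_g (o : option (bool * bool)) : F :=
  (if o is Some o then o.2 else false)%:R.

Lemma cube_kb o : cube_k o * cube_b o = 0.
Proof. by case: o => [[[] []]|]; rewrite ?mul0r ?mulr0. Qed.

Lemma cube_kg o : cube_k o * cube_g o = 0.
Proof. by case: o => [[[] []]|]; rewrite ?mul0r ?mulr0. Qed.

(* Coordinates with respect to a basis x, x^2, x^3, y, where y = x^4 for None
   and x y = 0, y x = b x^3, y^2 = g x^3, x^4 = 0 for Some (b, g). *)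
Definition cube_alg o : assocAlg F :=
  @AssocAlg F (F^o * F^o * F^o * F^o)%type (cube_mul (cube_k o) (cube_b o)
    (cube_g o))
    (cube_mulA (cube_kb o) (cube_kg o)).

Lemma dim_cube_alg o : alg_dim (cube_alg o) = 4%N.
Proof. by rewrite /alg_dim dimvf. Qed.

Lemma cube_alg_nilpotent o : alg_nilpotent (cube_alg o).
Proof.
(* Five factors in all, the first one not being counted in the sequence. *)
exists 4 => [[[[a s] t] c]] [|x1 [|x2 [|x3 [|x4 [|//]]]]] // _.
case: x1 => [[[a1 s1] t1] c1]; case: x2 => [[[a2 s2] t2] c2].
case: x3 => [[[a3 s3] t3] c3]; case: x4 => [[[a4 s4] t4] c4].
by case: o => [o|]; congr (_, _, _, _); rewrite /= /cube_k /cube_b /cube_g /=;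
  ring.
Qed.

Lemma cube_alg_cube o : exists x : cube_alg o, x ** x ** x != 0.
Proof.
exists (1, 0, 0, 0); apply/eqP=> /(congr1 (fun u => u.1.2))/eqP; apply/negP.
by apply: (eq_neq0 _ (oner_neq0 F)); rewrite /=; ring.
Qed.

(** Three invariants suffice: a nonzero fourth power characterizes [None], commutativity means b =
    0, and the implication from x^3 = 0 to x^2 = 0 means g = 0. *)
Lemma cube_alg_inj o o' : alg_iso (cube_alg o) (cube_alg o') -> o = o'.
Proof.
have n10 : 1 <> 0 :> F by apply/eqP; apply: oner_neq0.
have x4 o1 : (exists x : cube_alg o1, x ** x ** x ** x != 0) <-> o1 = None.
  split=> [[[[[a s] t] c]]|->].
    case: o1 => [o1|//]; case/eqP.
    by congr (_, _, _, _); rewrite /= /cube_k /cube_b /cube_g /=; ring.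
  exists (1, 0, 0, 0); apply/eqP=> /(congr1 snd)/eqP; apply/negP.
  by apply: (eq_neq0 _ (oner_neq0 F)); rewrite /= /cube_k /cube_b /cube_g /=
    ?eqxx /=; ring.
have comm (b g : bool) :
    (forall x y : cube_alg (Some (b, g)), x ** y = y ** x) <-> b = false.
  split=> [cxy|-> [[[a s] t] c] [[[a' s'] t'] c']].
    have /(congr1 (fun u => u.1.2)) := cxy (0, 0, 0, 1) (1, 0, 0, 0).
    case: b {cxy} => //; rewrite /= /cube_b /cube_g /= => e; case: n10.
    transitivity (0 * 0 + 0 * 1 + 1 * 1 * 1 + g%:R * 1 * 0 : F); first by ring.
    by rewrite [LHS]e; ring.
  by congr (_, _, _, _); rewrite /= /cube_k /cube_b /cube_g /=; ring.
have sqr (b g : bool) : (forall x : cube_alg (Some (b, g)),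
    x ** x ** x = 0 -> x ** x = 0) <-> g = false.
  split=> [sq0|-> [[[a s] t] c] /(congr1 (fun u => u.1.2))].
    have /(congr1 (fun u => u.1.2)) : ((0, 0, 0, 1) : cube_alg (Some (b, g))) **
        (0, 0, 0, 1) = 0.
      apply: sq0.
      by congr (_, _, _, _); rewrite /= /cube_k /cube_b /cube_g /=; ring.
    case: g {sq0} => //; rewrite /= /cube_b /cube_g /= => e; case: n10.
    by rewrite -[RHS]e; ring.
  rewrite /= /cube_k /cube_b /cube_g /= => e.
  have a0 : a = 0.
    have /eqP : a * a * a = 0 :> F by rewrite -[RHS]e; ring.
    by rewrite !mulf_eq0 !orbb => /eqP.
  by congr (_, _, _, _); rewrite /= /cube_k /cube_b /cube_g /= a0; ring.
move=> iso; have iso' := alg_iso_sym iso.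
have x4_iso o1 o2 : alg_iso (cube_alg o1) (cube_alg o2) -> o1 = None ->
  o2 = None.
  case=> f [f' fK _] fM /x4[x x0]; apply/x4; exists (f x).
  by rewrite -!fM -(linear0 f) (can_eq fK).
have comm_iso b1 g1 b2 g2 : alg_iso (cube_alg (Some (b1,
  g1))) (cube_alg (Some (b2, g2))) ->
    b1 = false -> b2 = false.
  case=> f [f' fK f'K] fM /(comm b1 g1).2 cxy; apply/(comm b2 g2) => x y.
  by rewrite -[x]f'K -[y]f'K -!fM cxy.
have sqr_iso b1 g1 b2 g2 : alg_iso (cube_alg (Some (b1,
  g1))) (cube_alg (Some (b2, g2))) ->
    g1 = false -> g2 = false.
  case=> f [f' fK f'K] fM /(sqr b1 g1).2 sq0; apply/(sqr b2 g2) => x.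
  rewrite -[x]f'K -!fM -(linear0 f) => /(can_inj fK)/sq0 ->.
  by rewrite linear0.
case: o o' iso iso' => [[b g]|] [[b' g']|] iso iso' //.
- congr (Some (_, _)).
    move: (comm_iso _ _ _ _ iso) (comm_iso _ _ _ _ iso').
    by case: b b' {iso iso'} => [] [] // h1 h2;
      [move: (h2 erefl) | move: (h1 erefl)].
  move: (sqr_iso _ _ _ _ iso) (sqr_iso _ _ _ _ iso').
  by case: g g' {iso iso'} => [] [] // h1 h2;
    [move: (h2 erefl) | move: (h1 erefl)].
- by have := x4_iso _ _ iso' erefl.
- by have := x4_iso _ _ iso erefl.
Qed.

End CubeAlgebras.

(** Testing against linear functionals turns vector identities into scalar ones, within reach of
    [ring]. *)
Lemma scalar_eq (F : fieldType) (V : vectType F) (v w : V) :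
  (forall phi : {scalar V}, phi v = phi w) -> v = w.
Proof.
move=> e; rewrite (coord_vbasis (memvf v)) (coord_vbasis (memvf w)).
by apply: eq_bigr => i _; rewrite e.
Qed.

(** * Normal form of a nilpotent algebra of dimension 4 with a nonzero cube *)

Section CubeComplete.

Variables (F : fieldType) (A : assocAlg F).
Hypothesis (dA : alg_dim A = 4%N) (nilA : alg_nilpotent A).
Implicit Types (x y z : A).

Lemma cube_alg_iso o x y :
  x ** x ** x ** x = cube_k F o *: y -> x ** y = 0 ->
  y ** x = cube_b F o *: (x ** x ** x) -> y ** y = cube_g F o *: (x ** x ** x)
    ->
  (forall a s t c, a *: x + s *: (x ** x) + t *: (x ** x ** x) + c *: y = 0 ->
    [/\ a = 0, s = 0, t = 0 & c = 0]) ->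
  alg_iso A (cube_alg F o).
Proof.
move=> x4 xy yx yy free; apply: alg_iso_sym.
pose f (u : cube_alg F o) : A := u.1.1.1 *: x + u.1.1.2 *: (x ** x) +
  u.1.2 *: (x ** x ** x) + u.2 *: y.
have f_lin : linear f.
  move=> l [[[a s] t] c] [[[a' s'] t'] c']; apply: scalar_eq => phi.
  have scaleE (u v : F) : u *: (v : F^o) = u * v by [].
  by rewrite /f /= !scaleE !(linearD, linearZ) /=; ring.
pose fM := GRing.isLinear.Build F _ _ _ f f_lin.
pose fL : {linear cube_alg F o -> A} := HB.pack f fM.
have finj : injective fL.
  by apply: raddf_inj => -[[[a s] t] c] /free /= [-> -> -> ->].
apply: (alg_isoI finj); first by rewrite dim_cube_alg dA.
have kb z : cube_b F o *: (cube_k F o *: z) = 0.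
  by rewrite scalerA mulrC cube_kb scale0r.
have kg z : cube_g F o *: (cube_k F o *: z) = 0.
  by rewrite scalerA mulrC cube_kg scale0r.
set k := cube_k F o in x4 kb kg *; set b := cube_b F o in yx kb *.
set g := cube_g F o in yy kg *.
set x2 := x ** x in x4 yx yy free f f_lin fM fL finj *.
set x3 := x2 ** x in x4 yx yy free f f_lin fM fL finj *.
have xx2 : x ** x2 = x3 by rewrite /x3 /x2 alg_mulA.
have xx3 : x ** x3 = k *: y by rewrite -x4 /x3 alg_mulA xx2.
have x2x2 : x2 ** x2 = k *: y by rewrite -x4 {2}/x2 alg_mulA.
have x2x3 : x2 ** x3 = 0 by rewrite {1}/x2 -alg_mulA xx3 linearZr_LR xy scaler0.
have x3x2 : x3 ** x2 = 0 by rewrite {1}/x3 -alg_mulA xx2 x2x3.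
have x3x3 : x3 ** x3 = 0 by rewrite {1}/x3 -alg_mulA xx3 linearZr_LR /x2
  -alg_mulA xy linear0r scaler0.
have x2y : x2 ** y = 0 by rewrite /x2 -alg_mulA xy linear0r.
have x3y : x3 ** y = 0 by rewrite /x3 -alg_mulA xy linear0r.
have yx2 : y ** x2 = 0 by rewrite /x2 alg_mulA yx linearZl_LR x4 kb.
have yx3 : y ** x3 = 0 by rewrite /x3 alg_mulA yx2 linear0l.
move=> [[[a s] t] c] [[[a' s'] t'] c']; rewrite /= /f /=.
rewrite !(linearDl, linearDr) !linearZl_LR !linearZr_LR.
rewrite -/x2 -/x3 xx2 xx3 xy x4 x2x2 x2x3 x2y x3x2 x3x3 x3y yx yx2 yx3 yy.
apply: scalar_eq => phi.
by rewrite !(linearD, linearZ, linear0) /=; ring.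
Qed.

Lemma dim_powv_le k : (k <= 4)%N -> (\dim (powv A k) <= 4 - k)%N.
Proof.
elim: k => [_|k IHk k4]; first by rewrite -[X in (_ <= X)%N]dA.
have [k0|k0] := eqVneq (powv A k) 0%VS.
  have := dimvS (powvS A k); rewrite k0 dimv0 leqn0 => /eqP->.
  exact: leq0n.
rewrite -ltnS subnS prednK ?subn_gt0 //.
by apply: leq_trans (ltn_dim_powv nilA k0) (IHk (ltnW k4)).
Qed.

Lemma powv4 : powv A 4 = 0%VS.
Proof. by apply/eqP; rewrite -dimv_eq0 -leqn0;
  apply: (dim_powv_le (leqnn 4)). Qed.

Lemma mul5_eq0 (a b c d e : A) : a ** b ** c ** d ** e = 0.
Proof.
apply/eqP; rewrite -memv0 -powv4; do 4 apply: mul_powvr.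
exact: memvf.
Qed.

(* An operator moving every power of A into the next one is nilpotent, hence
   has eigenvalue 0 on the line spanned by z modulo an invariant subspace. *)
Lemma nilpotent_eigen0 (T : {linear A -> A}) (V : {vspace A}) z c :
  (forall k v, v \in powv A k -> T v \in powv A k.+1) ->
  (forall v, v \in V -> T v \in V) -> z \notin V -> T z - c *: z \in V -> c = 0.
Proof.
move=> Tpow TV zV Tz; have Tn n : iter n T z - c ^+ n *: z \in V.
  elim: n => [|n IHn]; first by rewrite /= scale1r subrr mem0v.
  have -> : iter n.+1 T z - c ^+ n.+1 *: z =
      T (iter n T z - c ^+ n *: z) + c ^+ n *: (T z - c *: z).
    by rewrite (linearB T) (linearZ_LR T) scalerBr addrA subrK scalerA -exprSr.
  by rewrite memvD ?memvZ ?TV.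
have Tpn n : iter n T z \in powv A n.
  by elim: n => [|n IHn]; [apply: memvf | apply: Tpow].
have := Tn 4; have := Tpn 4; rewrite powv4 memv0 => /eqP->.
rewrite sub0r memvN => cV; apply/eqP/negPn/negP=> c0; case/negP: zV.
by rewrite -[z](scalerK (expf_neq0 4 c0)) memvZ.
Qed.

Lemma free4_span (x1 x2 x3 x4 : A) :
  (forall a s t c, a *: x1 + s *: x2 + t *: x3 + c *: x4 = 0 ->
    [/\ a = 0, s = 0, t = 0 & c = 0]) ->
  forall v, exists a s t c, v = a *: x1 + s *: x2 + t *: x3 + c *: x4.
Proof.
move=> free v; pose X := [tuple x1; x2; x3; x4].
have comb (k : 'I_4 -> F) : \sum_i k i *: X`_i =
    k (inord 0) *: x1 + k (inord 1) *: x2 + k (inord 2) *: x3 + k (inord 3) *: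
      x4.
  rewrite !big_ord_recl big_ord0 addr0 !addrA /=.
  by congr (k _ *: _ + k _ *: _ + k _ *: _ + k _ *: _);
    apply: val_inj; rewrite /= inordK.
have /span_basis Xspan : basis_of fullv X.
  rewrite basisEfree subvf -/(alg_dim A) dA /= andbT; apply/freeP => k.
  rewrite comb => /free[k0 k1 k2 k3] i; rewrite -(inord_val i).
  by case: i => [[|[|[|[|//]]]] i4] /=.
have : v \in <<X>>%VS by rewrite Xspan memvf.
by move/coord_span->; rewrite comb; do 4 eexists.
Qed.

Section Cube.

Variable x : A.
Hypotheses (x3_neq0 : x ** x ** x != 0) (x4_0 : x ** x ** x ** x = 0).

Let x2 := x ** x.
Let x3 := x2 ** x.
Let V := (<[x]> + <[x2]> + <[x3]>)%VS.
Let V' := (<[x2]> + <[x3]>)%VS.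

Let VP v : reflect (exists a s t, v = a *: x + s *: x2 + t *: x3) (v \in V).
Proof.
apply: (iffP memv_addP) => [[u /memv_addP[w /vlineP[a ->] [w' /vlineP[s ->]
  ->]]]|].
  by case=> w'' /vlineP[t ->] ->; exists a, s, t.
move=> [a [s [t ->]]]; exists (a *: x + s *: x2).
  by apply/memv_addP; exists (a *: x); last exists (s *: x2);
    rewrite ?memvZ ?memv_line.
by exists (t *: x3); rewrite ?memvZ ?memv_line.
Qed.

Let V'P v : reflect (exists s t, v = s *: x2 + t *: x3) (v \in V').
Proof.
apply: (iffP memv_addP) => [[w /vlineP[s ->] [w' /vlineP[t ->] ->]]|[s [t ->]]].
  by exists s, t.
by exists (s *: x2); last exists (t *: x3); rewrite ?memvZ ?memv_line.
Qed.

Let xx2 : x ** x2 = x3. Proof. by rewrite /x3 /x2 alg_mulA. Qed.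
Let xx3 : x ** x3 = 0. Proof. by rewrite /x3 alg_mulA xx2; apply: x4_0. Qed.
Let x2x : x2 ** x = x3. Proof. by []. Qed.
Let x3x : x3 ** x = 0. Proof. exact: x4_0. Qed.

Let free2 s t : s *: x2 + t *: x3 = 0 -> s = 0 /\ t = 0.
Proof.
move=> e; have s0 : s = 0.
  apply/eqP; have /eqP := congr1 (alg_mul A x) e.
  rewrite linearDr !linearZr_LR xx2 xx3 scaler0 addr0 linear0r scaler_eq0.
  by rewrite (negPf x3_neq0) orbF.
split=> //; apply/eqP; move/eqP: e; rewrite s0 scale0r add0r scaler_eq0.
by rewrite (negPf x3_neq0) orbF.
Qed.

Let free3 a s t : a *: x + s *: x2 + t *: x3 = 0 -> [/\ a = 0, s = 0 & t = 0].
Proof.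
move=> e; have [a0 s0] : a = 0 /\ s = 0.
  apply: free2; have := congr1 (alg_mul A x) e.
  by rewrite !linearDr !linearZr_LR xx2 xx3 scaler0 addr0 linear0r.
by move: e; rewrite a0 s0 scale0r add0r => /free2[_ ->].
Qed.

Let free4 y : y \notin V -> forall a s t c,
  a *: x + s *: x2 + t *: x3 + c *: y = 0 -> [/\ a = 0, s = 0, t = 0 & c = 0].
Proof.
move=> yV a s t c e; have c0 : c = 0.
  apply/eqP/negPn/negP=> c0; case/negP: yV.
  have -> : y = - c^-1 *: (a *: x + s *: x2 + t *: x3).
    move/eqP: e; rewrite addr_eq0 => /eqP->.
    by rewrite scaleNr scalerN opprK scalerK.
  by apply/memvZ/VP; exists a, s, t.
by move: e; rewrite c0 scale0r addr0 => /free3[-> -> ->].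
Qed.

Lemma cube_complement : exists y b g,
  [/\ x ** y = 0, y ** x = b *: x3, y ** y = g *: x3 &
    forall a s t c, a *: x + s *: x2 + t *: x3 + c *: y = 0 ->
      [/\ a = 0, s = 0, t = 0 & c = 0]].
Proof.
have [y0 _ y0V] : exists2 y0, y0 \in fullv & y0 \notin V.
  apply/subvPn/negP=> /dimvS; rewrite -/(alg_dim A) dA leqNgt => /negP[].
  have line v : (\dim <[v]> <= 1)%N by rewrite dim_vline leq_b1.
  suff : (\dim V <= 1 + 1 + 1)%N by [].
  rewrite (leq_trans (dimv_add_leqif _ _).1) // leq_add ?line //.
  by rewrite (leq_trans (dimv_add_leqif _ _).1) // leq_add ?line.
have xV v : v \in V -> x ** v \in V.
  case/VP=> [a [s [t ->]]]; apply/VP; exists 0, a, s.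
  by rewrite !linearDr !linearZr_LR xx2 xx3 scaler0 addr0 scale0r add0r.
have [p0 [p1 [p2 [p3 xy0]]]] := free4_span (free4 y0V) (x ** y0).
have p30 : p3 = 0.
  apply: (nilpotent_eigen0 (T := alg_mul A x) _ xV y0V).
    by move=> k v; apply: mul_powvl.
  by rewrite [X in X - _]xy0 addrK; apply/VP; exists p0, p1, p2.
rewrite p30 scale0r addr0 in xy0.
have x2y0 : x2 ** y0 = p0 *: x2 + p1 *: x3.
  rewrite /x2 -alg_mulA xy0 !linearDr !linearZr_LR xx2 xx3.
  by rewrite scaler0 addr0.
have x3y0 : x3 ** y0 = p0 *: x3.
  rewrite -xx2 -alg_mulA x2y0 !linearDr !linearZr_LR xx2 xx3.
  by rewrite scaler0 addr0.
(* Right multiplication by [y0] preserves the span of [x2], [x3] and has eigenvalue [p0] at [x]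
   modulo that span. *)
have p00 : p0 = 0.
  apply: (nilpotent_eigen0 (T := applyr (alg_mul A) y0) (V := V') (z := x)).
  - by move=> k v; apply: mul_powvr.
  - move=> v /V'P[s [t ->]]; apply/V'P; exists (s * p0), (s * p1 + t * p0).
    rewrite /= linearDl !linearZl_LR x2y0 x3y0 scalerDr !scalerA scalerDl.
    by rewrite addrA.
  - apply/negP=> /V'P[s [t ex]].
    have [] := @free3 1 (- s) (- t); last by move=> /eqP; rewrite oner_eq0.
    by rewrite scale1r {1}ex !scaleNr -addrA -opprD subrr.
  - apply/V'P; exists p1, p2.
    rewrite [X in X - _]xy0; apply: scalar_eq => phi.
    by rewrite !(linearD, linearN, linearZ) /=; ring.
rewrite p00 scale0r add0r in xy0.
(* What is left of [x ** y0] is [x ** (p1 *: x + p2 *: x2)], so this correction gives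
   [x ** y = 0]. *)
pose y := y0 - (p1 *: x + p2 *: x2).
have yV : y \notin V.
  apply: contra y0V => yV; rewrite -[y0](subrK (p1 *: x + p2 *: x2)).
  apply: memvD yV _; apply/VP; exists p1, p2, 0.
  by rewrite scale0r addr0.
have xy : x ** y = 0.
  by rewrite /y linearBr linearDr !linearZr_LR xx2 xy0 subrr.
have x2y : x2 ** y = 0 by rewrite /x2 -alg_mulA xy linear0r.
have x3y : x3 ** y = 0 by rewrite /x3 -alg_mulA xy linear0r.
(* Since [x ** y = 0], left multiplication by [x] kills both [y ** x] and [y ** y]; hence neither
   has a component along [x] or [x2]. *)
have left0 a s t c : x ** (a *: x + s *: x2 + t *: x3 + c *: y) = 0 ->
    a = 0 /\ s = 0.
  rewrite !linearDr !linearZr_LR xx2 xx3 xy !scaler0 !addr0; exact: free2.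
have [s0 [s1 [s2 [s3 yx]]]] := free4_span (free4 yV) (y ** x).
have [s00 s10] : s0 = 0 /\ s1 = 0.
  by apply: (left0 _ _ s2 s3); rewrite -yx alg_mulA xy linear0l.
rewrite s00 s10 !scale0r !add0r in yx.
have s30 : s3 = 0.
  apply: (nilpotent_eigen0 (T := applyr (alg_mul A) x) (V := V) (z := y)) yV _.
  - by move=> k v; apply: mul_powvr.
  - move=> v /VP[a [s [t ->]]]; apply/VP; exists 0, a, s.
    by rewrite /= !linearDl !linearZl_LR x3x x2x scaler0 addr0 scale0r add0r.
  - rewrite [X in X - _]yx addrK; apply/VP; exists 0, 0, s2.
    by rewrite !scale0r !add0r.
rewrite s30 scale0r addr0 in yx.
have yx2 : y ** x2 = 0 by rewrite /x2 alg_mulA yx linearZl_LR x3x scaler0.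
have yx3 : y ** x3 = 0 by rewrite /x3 alg_mulA yx2 linear0l.
have [r0 [r1 [r2 [r3 yy]]]] := free4_span (free4 yV) (y ** y).
have [r00 r10] : r0 = 0 /\ r1 = 0.
  by apply: (left0 _ _ r2 r3); rewrite -yy alg_mulA xy linear0l.
rewrite r00 r10 !scale0r !add0r in yy.
have r30 : r3 = 0.
  apply: (nilpotent_eigen0 (T := alg_mul A y) (V := V) (z := y)) yV _.
  - by move=> k v; apply: mul_powvl.
  - move=> v /VP[a [s [t ->]]]; apply/VP; exists 0, 0, (a * s2).
    rewrite -[LHS]/(y ** _) !linearDr !linearZr_LR yx yx2 yx3 !scaler0 !addr0.
    by rewrite !scale0r !add0r scalerA.
  - rewrite [X in X - _]yy addrK; apply/VP; exists 0, 0, r2.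
    by rewrite !scale0r !add0r.
rewrite r30 scale0r addr0 in yy.
by exists y, s2, r2; split=> //; apply: free4 yV.
Qed.

End Cube.

Lemma cube_alg_complete x : x ** x ** x != 0 -> exists o,
  alg_iso A (cube_alg F o).
Proof.
move=> x30; have [x40|x40] := eqVneq (x ** x ** x ** x) 0; last first.
  have x5 : x ** (x ** x ** x ** x) = 0 by rewrite !alg_mulA mul5_eq0.
  have x5' : x ** x ** x ** x ** x = 0 by exact: mul5_eq0.
  exists None; apply: (@cube_alg_iso _ x (x ** x ** x ** x)).
  - by rewrite /cube_k eqxx scale1r.
  - exact: x5.
  - by rewrite /cube_b scale0r.
  - by rewrite /cube_g scale0r !alg_mulA !x5' !linear0l.
  have cancel c : c *: (x ** x ** x ** x) = 0 -> c = 0.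
    by move/eqP; rewrite scaler_eq0 (negPf x40) orbF => /eqP.
  have mulx a s t c :
      x ** (a *: x + s *: (x ** x) + t *: (x ** x ** x) + c *: (x ** x ** x **
        x)) =
      0 *: x + a *: (x ** x) + s *: (x ** x ** x) + t *: (x ** x ** x ** x).
    by rewrite !linearDr !linearZr_LR x5 scaler0 addr0 scale0r add0r !alg_mulA.
  move=> a s t c e0; have e1 := congr1 (alg_mul A x) e0.
  rewrite mulx linear0r in e1; have e2 := congr1 (alg_mul A x) e1.
  rewrite mulx linear0r in e2; have e3 := congr1 (alg_mul A x) e2.
  rewrite mulx linear0r !scale0r !add0r in e3; have a0 := cancel _ e3.
  rewrite a0 !scale0r !add0r in e0 e1 e2; have s0 := cancel _ e2.
  rewrite s0 !scale0r !add0r in e0 e1; have t0 := cancel _ e1.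
  by rewrite t0 scale0r add0r in e0; have c0 := cancel _ e0.
have [y [b [g [xy yx yy free]]]] := cube_complement x30 x40.
(* Replacing x by l x and y by e y turns b into e b / l^2 and g into e^2 g / l^3. Both can be made 1
   without extracting roots: if b and g are nonzero, l = b^2 / g and e = b^3 / g^2 solve the
   equations. *)
suff [l [e [l0 e0 [hb hg]]]] : exists l e : F, [/\ l != 0, e != 0 &
    e * b = (b != 0)%:R * l ^+ 2 /\ e ^+ 2 * g = (g != 0)%:R * l ^+ 3].
  exists (Some (b != 0, g != 0)); apply: (@cube_alg_iso _ (l *: x) (e *: y)).
  - rewrite !(linearZl_LR, linearZr_LR) x40 !scaler0.
    by rewrite /cube_k /= scale0r.
  - by rewrite linearZl_LR linearZr_LR xy !scaler0.
  - rewrite !(linearZl_LR, linearZr_LR) yx !scalerA /cube_b /=.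
    by congr (_ *: _); transitivity (l * (e * b)); [ring | rewrite hb; ring].
  - rewrite !(linearZl_LR, linearZr_LR) yy !scalerA /cube_g /=.
    by congr (_ *: _); transitivity (e ^+ 2 * g); [ring | rewrite hg; ring].
  move=> a s t c; rewrite !(linearZl_LR, linearZr_LR) !scalerA.
  case/free=> /eqP; rewrite mulf_eq0 (negPf l0) orbF => /eqP a0 /eqP.
  rewrite !mulf_eq0 (negPf l0) !orbF => /eqP s0 /eqP.
  rewrite !mulf_eq0 (negPf l0) !orbF => /eqP t0 /eqP.
  by rewrite mulf_eq0 (negPf e0) orbF => /eqP c0.
have [->|b0] := eqVneq b 0; have [->|g0] := eqVneq g 0 => /=.
- by exists 1, 1; rewrite oner_eq0; split=> //; split; ring.
- by exists g, g; rewrite g0; split=> //; split; ring.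
- by exists 1, b^-1; rewrite oner_eq0 invr_eq0; split=> //; split; field.
- exists (b ^+ 2 / g), (b ^+ 3 / g ^+ 2).
  by rewrite !mulf_neq0 ?invr_eq0 ?expf_neq0 //; split=> //; split; field;
    rewrite ?g0 ?b0.
Qed.

End CubeComplete.

(** * Nonzero triple products force a nonzero cube *)

Section ExistsCube.

Variables (F : fieldType) (A : assocAlg F).
Hypothesis (dA : alg_dim A = 4%N) (nilA : alg_nilpotent A).
Implicit Types (x y z : A).

Lemma mulv_neq0 (U V : {vspace A}) (T : {linear A -> A}) z :
  z \in mulv U V -> T z != 0 -> exists u v, u \in U /\ T (u ** v) != 0.
Proof.
move=> zUV Tz0; set X := [seq u ** v | u <- vbasis U, v <- vbasis V].
have [/hasP[_ /allpairsP[[u v] /= [uU vV ->]] Tuv]|no] :=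
  boolP (has (fun w => T w != 0) X).
  by exists u, v; split; first exact: vbasis_mem.
case/eqP: Tz0; suff : z \in lker (linfun T) by rewrite memv_ker lfunE => /eqP.
apply: subvP zUV; apply/span_subvP=> w wX; rewrite memv_ker lfunE /=.
by have /hasPn/(_ w wX) := no; rewrite negbK.
Qed.

Lemma powv2_neq0 : powv A 2 != 0%VS -> exists a b c : A, a ** b ** c != 0.
Proof.
move=> p20; pose X := [seq u ** v | u <- vbasis (powv A 1), v <- vbasis {:A}].
have [/hasP[_ /allpairsP[[u v] /= [uU vV ->]] uv0]|no] :=
  boolP (has (fun w => w != 0) X).
  have [a [b [_ ab]]] :=
    mulv_neq0 (T := applyr (alg_mul A) v) (vbasis_mem uU) uv0.
  by exists a, b, v.
case/negP: p20; rewrite -subv0; apply/span_subvP=> w wX.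
by have /hasPn/(_ w wX) := no; rewrite negbK => /eqP->; apply: mem0v.
Qed.

(** A nilpotent analogue of Nakayama's lemma: expanding products shows that A = X + A^n for every n,
    since X is closed under multiplication. *)
Lemma generated_by_complement (X : {vspace A}) :
  (forall x y, x \in X -> y \in X -> x ** y \in X) ->
  (fullv <= X + powv A 1)%VS -> X = fullv.
Proof.
move=> XX X1; suff all n : (fullv <= X + powv A n)%VS.
  have [n n0] := powv_nilpotent nilA; have := all n.
  by rewrite n0 addv0 => full; apply/eqP; rewrite eqEsubv subvf.
elim: n => [|n IHn]; first exact: addvSr.
apply: subv_trans X1 _; rewrite subv_add addvSl /=.
apply: mulv_subv => a b _ _.
have /memv_addP[u uX [u' u'n ->]] := subvP IHn a (memvf a).
have /memv_addP[v vX [v' v'n ->]] := subvP IHn b (memvf b).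
rewrite linearDl linearDr -addrA memv_add ?XX //.
by apply: memvD; [apply: mul_powvl | apply: mul_powvr].
Qed.

(** Here A/A^2 is a line, so any x outside A^2 generates A. If x^3 were 0, the span of x and x^2
    would be all of A, which has dimension 4. *)
Lemma exists_cube_one_generator : \dim (powv A 1) = 3%N ->
  exists x, x ** x ** x != 0.
Proof.
move=> d1; have [x _ x1] : exists2 x, x \in fullv & x \notin powv A 1.
  by apply/subvPn/negP=> /dimvS; rewrite d1 -/(alg_dim A) dA.
exists x; apply/eqP=> x30; pose X := (<[x]> + <[x ** x]>)%VS.
have XX u v : u \in X -> v \in X -> u ** v \in X.
  case/memv_addP=> _ /vlineP[a ->] [_ /vlineP[b ->] ->].
  case/memv_addP=> _ /vlineP[c ->] [_ /vlineP[d ->] ->].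
  rewrite !(linearDl, linearDr, linearZl_LR, linearZr_LR) !alg_mulA x30.
  rewrite linear0l !scaler0 !addr0.
  by rewrite (subvP (addvSr _ _)) // !memvZ // memv_line.
have : X = fullv.
  apply: generated_by_complement XX _.
  have : (<[x]> + powv A 1 == fullv)%VS.
    rewrite eqEdim subvf -/(alg_dim A) dA /=.
    suff : (\dim (powv A 1) < \dim (<[x]> + powv A 1))%N by rewrite d1.
    rewrite (ltn_leqif (dimv_leqif_sup (addvSr _ _))).
    by apply: contra x1 => /subvP; apply; rewrite (subvP (addvSl _ _))
      ?memv_line.
  by move=> /eqP <-; apply: addvS (addvSl _ _) (subvv _).
move/(congr1 (fun U => \dim U)); rewrite -/(alg_dim A) dA.
have line v : (\dim <[v]> <= 1)%N by rewrite dim_vline leq_b1.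
have : (\dim X <= 1 + 1)%N.
  by rewrite (leq_trans (dimv_add_leqif _ _).1) // leq_add ?line.
by case: (\dim X) => [|[|[|]]].
Qed.

(* Modulo the cubes, which annihilate A, every product is a multiple of a
   single element z, so a b c != 0 forces c^3 != 0. *)
Lemma exists_cube_two_generators (a b c : A) : \dim (powv A 1) = 2%N ->
  a ** b ** c != 0 -> c ** c ** c != 0.
Proof.
move=> d1 abc0; have n1 : powv A 1 != 0%VS by rewrite -dimv_eq0 d1.
have lt2 := ltn_dim_powv nilA n1; rewrite d1 in lt2.
have p2 : \dim (powv A 2) = 1%N.
  apply/eqP; rewrite eqn_leq -ltnS lt2 lt0n dimv_eq0.
  apply: contraNneq abc0 => p20; rewrite -memv0 -p20.
  by do 2 apply: mul_powvr; apply: memvf.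
have p3 : powv A 3 = 0%VS.
  have n2 : powv A 2 != 0%VS by rewrite -dimv_eq0 p2.
  have := ltn_dim_powv nilA n2.
  by rewrite p2 ltnS leqn0 dimv_eq0 => /eqP.
have [z z1 z2] : exists2 z, z \in powv A 1 & z \notin powv A 2.
  by apply/subvPn/negP=> /dimvS; rewrite p2 d1.
have dec u : u \in powv A 1 -> exists k,
    (forall v, u ** v = k *: (z ** v)) /\ (forall v, v ** u = k *: (v ** z)).
  have defU : (<[z]> + powv A 2 == powv A 1)%VS.
    rewrite eqEdim subv_add -memvE z1 powvS /= d1.
    suff : (\dim (powv A 2) < \dim (<[z]> + powv A 2))%N by rewrite p2.
    rewrite (ltn_leqif (dimv_leqif_sup (addvSr _ _))).
    by apply: contra z2 => /subvP; apply; rewrite (subvP (addvSl _ _))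
      ?memv_line.
  rewrite -(eqP defU) => /memv_addP[_ /vlineP[k ->] [w w2 ->]]; exists k.
  split=> v; rewrite (linearDl, linearDr) (linearZl_LR, linearZr_LR).
    have : w ** v \in powv A 3 by apply: mul_powvr.
    by rewrite p3 memv0 => /eqP->; rewrite addr0.
  have : v ** w \in powv A 3 by apply: mul_powvl.
  by rewrite p3 memv0 => /eqP->; rewrite addr0.
have sq u v : u ** v \in powv A 1 by rewrite mul_powvr ?memvf.
have [kab [kabl _]] := dec _ (sq a b); have [kbc [kbcl kbcr]] := dec _ (sq b c).
have [kcc [kccl kccr]] := dec _ (sq c c).
(* Nonvanishing passes along the chain (ab)c, a(bc), (bc)c, b(cc), (cc)c, with each bracket replaced
   by a multiple of [z]. *)
have zc0 : z ** c != 0.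
  by apply: contraNneq abc0 => zc0; rewrite kabl zc0 scaler0.
have kbc0 : kbc != 0.
  by apply: contraNneq abc0 => k0; rewrite -alg_mulA kbcr k0 scale0r.
have bcc0 : b ** c ** c != 0 by rewrite kbcl scaler_eq0 negb_or kbc0.
have kcc0 : kcc != 0.
  by apply: contraNneq bcc0 => k0; rewrite -alg_mulA kccr k0 scale0r.
by rewrite kccl scaler_eq0 negb_or kcc0.
Qed.

Lemma class2_or_cube : alg_class2 A \/ exists x, x ** x ** x != 0.
Proof.
have [p20|p20] := eqVneq (powv A 2) 0%VS.
  left=> x y z; apply/eqP; rewrite -memv0 -p20.
  by do 2 apply: mul_powvr; apply: memvf.
right; have [a [b [c abc0]]] := powv2_neq0 p20.
have p10 : powv A 1 != 0%VS.
  by apply: contraNneq p20 => p10; rewrite -subv0 -p10 powvS.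
(* A^3 is nonzero and smaller than A^2, whose dimension is at most 3: only 2 and 3 remain. *)
have := dim_powv_le dA nilA (k := 1) isT.
have := ltn_dim_powv nilA p10; rewrite -dimv_eq0 in p20.
case: (\dim (powv A 2)) p20 => // d2 _.
case d1: (\dim (powv A 1)) => [|[|[|[|]]]] // _ _.
  by exists c; apply: exists_cube_two_generators d1 abc0.
exact: exists_cube_one_generator d1.
Qed.

End ExistsCube.

Lemma class_count_cube (F : fieldType) :
  class_count (@alg_iso F) (fun A => [/\ alg_dim A = 4%N, alg_nilpotent A &
    exists x : A, x ** x ** x != 0]) 5.
Proof.
have -> : (5 = #|{: option (bool * bool)}|)%N.
  by rewrite card_option card_prod card_bool.
apply: (class_count_reps (r := cube_alg F)).
- move=> o; split; first exact: dim_cube_alg.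
    exact: cube_alg_nilpotent.
  exact: cube_alg_cube.
- exact: cube_alg_inj.
by move=> A [dA nilA [x x30]]; apply: cube_alg_complete dA nilA x x30.
Qed.

Local Close Scope ring_scope.

Theorem corollary7p4 (F : finFieldType) (p : nat)
    (Fchar : p \in [pchar F]%R) (p_odd : odd p) :
  iso_class_number
    (fun A : assocAlg F => alg_dim A = 4 /\ alg_nilpotent A)
    (5 * #|F| + 20).
Proof.
have two_neq0 : (2%:R != 0 :> F)%R.
  rewrite -(dvdn_pcharf Fchar); apply/negP=> /(@dvdn_leq p 2 isT) p2.
  by have := pcharf_prime Fchar; case: p p_odd p2 {Fchar} => [|[|[|]]].
have -> : 5 * #|F| + 20 = (5 * #|F| + 15) + 5 by rewrite -addnA.
apply: class_count_split (class_count_class2_dim4 two_neq0) (class_count_cube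
  F).
- move=> A; split=> [[dA nilA]|[[dA A2]|[dA nilA _]]] //.
    by case: (class2_or_cube dA nilA) => [A2|cube]; [left | right].
  by split=> //; apply: alg_class2_nilpotent.
move=> A B [_ A2] [_ _ [x x30]]; split=> AB; case/eqP: x30.
  exact: (alg_class2_iso AB A2).
exact: (alg_class2_iso (alg_iso_sym AB) A2).
Qed.
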